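(* Let $X$ be a nonsingular real algebraic surface and let $f_1,\ldots,f_r$ be continuous rational functions on $X$. For a continuous function $\varphi$ on $X$, the following conditions are equivalent: (a) The function $\varphi$ can be written in the form $\varphi=\varphi_1f_1+\cdots+\varphi_rf_r$, where the $\varphi_i$ are continuous functions on $X$. (b) The function $\varphi$ satisfies the pointwise test (PT) for the functions $f_1,\ldots,f_r$.
   Context: All functions are real-valued. A real algebraic variety is a locally ringed space isomorphic to an algebraic subset of $\mathbb{R}^n$, for some $n$, endowed with the Zariski topology and the sheaf of regular functions (what is often called an affine real algebraic variety). A real algebraic surface is a real algebraic variety of dimension $2$; it is not assumed irreducible. Each real algebraic variety also carries the Euclidean topology, and all topological notions (in particular continuity) refer to the Euclidean topology unless ''Zariski'' is explicitly mentioned. A function $f$ on a real algebraic variety $X$ is continuous rational if it is continuous on $X$ and regular on some Zariski open dense subset of $X$. Pointwise test: let $\Omega$ be a metric space and $f_1,\ldots,f_r$ continuous functions on $\Omega$. A continuous function $\varphi$ on $\Omega$ satisfies the PT for the $f_i$ if for every point $p\in\Omega$ the function $\varphi$ can be written as $\varphi=\psi_1^{(p)}f_1+\cdots+\psi_r^{(p)}f_r$ on $\Omega$, where the $\psi_i^{(p)}$ are functions on $\Omega$ (not necessarily continuous everywhere) that are continuous at $p$. *)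

(* Defs.v *)
From HB Require Import structures.
From mathcomp Require Import all_boot all_order all_algebra.
From mathcomp Require Import all_classical all_reals topology normedtype.
(* The notations of mpoly clash with those of MathComp-Analysis; only the
   types, functions and canonical structures are imported:
     mpoly n R = {mpoly R[n]},  meval v p = p.@[v],  mderiv j p = p^`M(j). *)
From mathcomp Require Import -(notations) mpoly.

Set Implicit Arguments.
Unset Strict Implicit.
Unset Printing Implicit Defensive.

Import Order.TTheory GRing.Theory Num.Theory.
Import numFieldNormedType.Exports.

Local Open Scope classical_set_scope.
Local Open Scope ring_scope.

(* Every real algebraic variety is, up to isomorphism, an algebraic subset X of
   some R^n = 'rV[R]_n.  The Euclidean topology of X is the library's subset
   topology on the type [set_type X] (to which [X : set _] coerces). *)

Definition zeros (R : realType) (n : nat) (S : set (mpoly n R)) : set 'rV[R]_n :=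
  [set x | forall P, S P -> meval (x 0) P = 0].

Definition algebraic (R : realType) (n : nat) (X : set 'rV[R]_n) : Prop :=
  exists S : set (mpoly n R), X = zeros S.

Definition vanishing_ideal (R : realType) (n : nat) (X : set 'rV[R]_n) :
    set (mpoly n R) :=
  [set P | forall x, X x -> meval (x 0) P = 0].

(* Strictly increasing chains p_0 < ... < p_k of prime ideals of the coordinate
   ring R[x_1, ..., x_n] / I(X), seen as prime ideals of the polynomial ring
   that contain I(X). *)
Definition prime_chain (R : realType) (n : nat) (X : set 'rV[R]_n) (k : nat)
    (p : 'I_k.+1 -> set (mpoly n R)) : Prop :=
  (forall i, [/\ vanishing_ideal X `<=` p i, idealr_closed [in p i] &
                 prime_idealr_closed [in p i]]) /\
  (forall i j : 'I_k.+1, (i < j)%N -> p i `<` p j).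

(* dim X = d, where dim X is the Krull dimension of the coordinate ring of X;
   the empty set has no dimension. *)
Definition has_dimension (R : realType) (n : nat) (X : set 'rV[R]_n) (d : nat) :
    Prop :=
  (exists p : 'I_d.+1 -> set (mpoly n R), prime_chain X p) /\
  (forall (k : nat) (p : 'I_k.+1 -> set (mpoly n R)),
    prime_chain X p -> (k <= d)%N).

Definition jacobian (R : realType) (n m : nat) (P : 'I_m -> mpoly n R)
    (x : 'rV[R]_n) : 'M[R]_(m, n) :=
  \matrix_(i, j) meval (x 0) (mderiv j (P i)).

(* x is a nonsingular point of X in dimension d (Akbulut-King, "Topology of real
   algebraic sets"; cf. Bochnak-Coste-Roy, "Real algebraic geometry", 3.3):
   near x, X is cut out by n - d polynomials of I(X) with linearly independent
   gradients at x. *)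
Definition nonsingular_at (R : realType) (n : nat) (X : set 'rV[R]_n) (d : nat)
    (x : 'rV[R]_n) : Prop :=
  exists (m : nat) (P : 'I_m -> mpoly n R) (U : set 'rV[R]_n),
    [/\ (m + d = n)%N, (forall i, vanishing_ideal X (P i)),
        row_free (jacobian P x), nbhs x U &
        X `&` U = zeros (range P) `&` U].

Definition nonsingular_variety (R : realType) (n : nat) (X : set 'rV[R]_n)
    (d : nat) : Prop :=
  [/\ algebraic X, has_dimension X d & forall x, X x -> nonsingular_at X d x].

Definition nonsingular_surface (R : realType) (n : nat) (X : set 'rV[R]_n) :
    Prop := nonsingular_variety X 2.

Section functions_on_a_variety.
Variables (R : realType) (n : nat) (X : set 'rV[R]_n).

Definition zariski_open (D : set X) : Prop :=
  exists S : set (mpoly n R), D = [set x | ~ zeros S (set_val x)].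

Definition zariski_dense (D : set X) : Prop :=
  forall U : set X, zariski_open U -> U !=set0 -> U `&` D !=set0.

(* regularity on a Zariski open D: locally on D, in the Zariski topology, f is a
   quotient of two polynomials *)
Definition regular_on (D : set X) (f : X -> R) : Prop :=
  forall x, D x -> exists (U : set X) (P Q : mpoly n R),
    [/\ zariski_open U, U x & forall y, (D `&` U) y ->
        meval (set_val y 0) Q != 0 /\
        f y = meval (set_val y 0) P / meval (set_val y 0) Q].

Definition continuous_rational (f : X -> R) : Prop :=
  continuous f /\
  exists D : set X, [/\ zariski_open D, zariski_dense D & regular_on D f].

End functions_on_a_variety.

Definition pointwise_test (R : realType) (T : topologicalType) (r : nat)
    (f : 'I_r -> T -> R) (phi : T -> R) : Prop :=
  forall p : T, exists psi : 'I_r -> T -> R,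
    (forall i, {for p, continuous (psi i)}) /\
    (forall x, phi x = \sum_(i < r) psi i x * f i x).

(* Main.v *)
(* Write [f = (f_1, ..., f_r)] and call a point good if, near it, either [f] is
   identically zero, or [f] is nonzero on a dense set and the line spanned by [f]
   has a limit.  Given [v] continuous, [v + (phi - v.f) f / |f|^2] solves the
   equation where [f <> 0]; by the pointwise test it equals
   [v + pi (psi^(q) - v)], [pi] being the projection onto that line, so it extends
   continuously to every good point [q].  Since [pi] is bounded, it also extends
   to an isolated bad point [p] as soon as [v p = psi^(p) p], a condition which
   can be met at all bad points at once.

   It remains to see that bad points are isolated.  Locally [f_i = F_i / Q] with
   polynomials [F_i], [Q].  If bad points accumulated, some infinite set [S] of
   them would have a prime vanishing ideal [I] which does not grow on infinite
   subsets of [S].  Let [D] be the derivation along the fibres of a coordinate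
   [s], chosen transversally to [f], let [m] be minimal such that some
   [D^m F_k] is not in [I], and let [G = D^(m-1) F_k].  If [I] is stable under the
   Jacobian bracket with [G], the generators of [I] satisfy a linear differential
   system along the curve [G = 0] and vanish on it; then all [D^j F_i], [j < m],
   vanish on this curve and [F_i / F_k] has a limit by Cauchy's mean value
   theorem, so that a generic point of [S] is good.  Otherwise [I] contains [n]
   polynomials whose Jacobian determinant is not in [I], which is impossible since
   a prime ideal with infinitely many zeros is preserved by a vector field that
   is nonzero modulo [I].

   The dimension hypothesis enters through Zariski density only: a dense Zariski
   open set meets every chart, for otherwise there would be a chain of four prime
   ideals. *)
Require Import Defs.
From HB Require Import structures.
From mathcomp Require Import all_boot all_order all_algebra perm.
From mathcomp Require Import all_classical all_reals interval_inference topology normedtype.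
From mathcomp Require Import sequences derive realfun exp.
From mathcomp Require Import -(notations) mpoly.
From mathcomp Require Import zify ring lra.

Set Implicit Arguments.
Unset Strict Implicit.
Unset Printing Implicit Defensive.

Import Order.TTheory GRing.Theory Num.Theory.
Import numFieldNormedType.Exports.

Local Open Scope classical_set_scope.
Local Open Scope ring_scope.

(** * Noetherian rings and vanishing ideals *)

Local Notation "''X_' i" := (@mpolyX _ _ (mnm1 i)) (at level 8, i at level 2, format "''X_' i").

Lemma mpoly_ring_ind (R : comNzRingType) (n : nat) (P : mpoly n R -> Prop) :
  (forall c, P (mpolyC n c)) -> (forall i, P 'X_i) ->
  (forall p q, P p -> P q -> P (p + q)) ->
  (forall p q, P p -> P q -> P (p * q)) -> forall p, P p.
Proof.
move=> PC PX PD PM; apply: mpolyind => [|c m p _ _ Pp]; first by rewrite -mpolyC0.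
apply: PD => //; rewrite -mul_mpolyC; apply: (PM) => //.
rewrite mpolyXE_id; apply: (big_ind P _ PM) => [|i _]; first by rewrite -mpolyC1.
elim: (m i) => [|k IH]; first by rewrite expr0 -mpolyC1.
by rewrite exprS; apply: PM.
Qed.

Definition is_ideal (A : comNzRingType) (I : set A) : Prop :=
  [/\ I 0, forall x y, I x -> I y -> I (x + y) & forall a x, I x -> I (a * x)].

(* Finite generation is phrased through the ideals containing the generators,
   which avoids explicit linear combinations. *)
Definition noetherian (A : comNzRingType) : Prop :=
  forall I : set A, is_ideal I -> exists s : seq A,
    (forall x, x \in s -> I x) /\
    forall J, is_ideal J -> (forall x, x \in s -> J x) -> I `<=` J.

Lemma is_idealN (A : comNzRingType) (I : set A) x : is_ideal I -> I x -> I (- x).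
Proof. by case=> _ _ IM Ix; rewrite -mulN1r; apply: IM. Qed.

Lemma is_idealB (A : comNzRingType) (I : set A) x y :
  is_ideal I -> I x -> I y -> I (x - y).
Proof. by move=> iI Ix Iy; have [_ ID _] := iI; apply: ID => //; apply: is_idealN. Qed.

Lemma is_ideal_sum (A : comNzRingType) (I : set A) (T : finType) (F : T -> A) :
  is_ideal I -> (forall i, I (F i)) -> I (\sum_i F i).
Proof. by case=> I0 ID _ IF; apply: (big_ind I _ ID). Qed.

Lemma noetherian_field (K : fieldType) : noetherian K.
Proof.
move=> I [I0 ID IM]; have [[x Ix xn0]|noI] := pselect (exists2 x, I x & x != 0).
  exists [:: x]; split=> [y|J [J0 JD JM] xJ y Iy]; first by rewrite inE => /eqP ->.
  by rewrite -(divfK xn0 y); apply/JM/xJ; rewrite inE.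
exists [::]; split=> // J [J0 _ _] _ y Iy.
by have [->//|yn0] := eqVneq y 0; case: noI; exists y.
Qed.

Lemma noetherian_surj (A B : comNzRingType) (h : {rmorphism A -> B}) :
  (forall b, exists a, h a = b) -> noetherian A -> noetherian B.
Proof.
have idpre (I : set B) : is_ideal I -> is_ideal (h @^-1` I).
  move=> [I0 ID IM]; split=> [|x y|a x] /=; rewrite ?rmorph0 ?rmorphD ?rmorphM //.
    exact: ID.
  exact: IM.
move=> surj nA I iI; have [s [sI sgen]] := nA _ (idpre _ iI).
exists (map h s); split=> [x /mapP[a /sI Iha ->]//|J iJ sJ x Ix].
have [a ha] := surj x; rewrite -ha; apply: (sgen (h @^-1` J)) => //.
- exact: idpre.
- by move=> b bs; apply: sJ; rewrite map_f.
- by rewrite /= ha.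
Qed.

(** Hilbert's basis theorem. The ideals [L I d] of coefficients in degree [d] increase with [d], so
    all of them lie in some [L I D]; lifting generators of [L I 0], ..., [L I D] to [I] gives enough
    polynomials to cancel any leading coefficient. *)
Lemma noetherian_poly (A : comNzRingType) : noetherian A -> noetherian {poly A}.
Proof.
move=> nA I iI; have [I0 ID IM] := iI.
pose L (J : set {poly A}) d :=
  [set a : A | exists p, [/\ J p, (size p <= d.+1)%N & p`_d = a]].
have Lid J d : is_ideal J -> is_ideal (L J d).
  move=> [J0 JD JM]; split.
  - by exists 0; rewrite size_poly0 coef0.
  - move=> x y [p [Jp sp <-]] [q [Jq sq <-]]; exists (p + q); rewrite coefD; split=> //.
      exact: JD.
    by rewrite (leq_trans (size_polyD _ _))// geq_max sp.
  - move=> a x [p [Jp sp <-]]; exists (a%:P * p); rewrite coefCM; split=> //.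
      exact: JM.
    by rewrite mul_polyC (leq_trans (size_scale_leq _ _)).
have LS d e : (d <= e)%N -> L I d `<=` L I e.
  move=> de a [p [Ip sp <-]]; exists ('X^(e - d) * p); split.
  - exact: IM.
  - rewrite (leq_trans (size_polyMleq _ _))// size_polyXn /=.
    by rewrite (leq_trans (leq_add (leqnn _) sp))// addnS subnK.
  - by rewrite coefXnM ltnNge leq_subr /= subKn.
have [s [sL sgen]] : exists s : seq A, (forall x, x \in s -> exists d, L I d x) /\
    forall J, is_ideal J -> (forall x, x \in s -> J x) -> forall d, L I d `<=` J.
  have [|s [sL sgen]] := nA [set a | exists d, L I d a].
    split.
    - by exists 0%N; have [] := Lid _ 0%N iI.
    - move=> x y [d Lx] [e Ly]; exists (maxn d e); have [_ LD _] := Lid _ (maxn d e) iI.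
      by apply: LD; [apply: LS Lx; rewrite leq_maxl|apply: LS Ly; rewrite leq_maxr].
    - by move=> a x [d Lx]; exists d; have [_ _] := Lid _ d iI; apply.
  exists s; split=> [x /sL//|J iJ sJ d x Lx].
  by apply: (sgen J iJ sJ); exists d.
have [D sD] : exists D, forall x, x \in s -> L I D x.
  elim: s sL {sgen} => [|x s IH] sL; first by exists 0%N.
  have [|D HD] := IH; first by move=> y ys; apply: sL; rewrite inE ys orbT.
  have [|d Hd] := sL x; first by rewrite inE eqxx.
  exists (maxn d D) => y; rewrite inE => /predU1P[->|/HD].
    by apply: LS Hd; rewrite leq_maxl.
  by apply: LS; rewrite leq_maxr.
have LD d : L I d `<=` L I D by apply: (sgen _ (Lid _ D iI) sD).
have gen1 d : exists t : seq {poly A}, (forall p, p \in t -> I p) /\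
    forall J, is_ideal J -> J `<=` I -> (forall p, p \in t -> J p) -> L I d `<=` L J d.
  have [u [uL ugen]] := nA _ (Lid _ d iI).
  have [t [tI tu]] : exists t : seq {poly A}, (forall p, p \in t -> I p) /\
     forall x, x \in u -> exists p, [/\ p \in t, (size p <= d.+1)%N & p`_d = x].
    elim: u uL {ugen} => [|x u IH] uL; first by exists [::].
    have [|t [tI tu]] := IH; first by move=> y yu; apply: uL; rewrite inE yu orbT.
    have [|p [Ip sp pd]] := uL x; first by rewrite inE eqxx.
    exists (p :: t); split=> [q|y].
      by rewrite inE => /predU1P[->|/tI].
    rewrite inE => /predU1P[->|/tu[q [qt sq qd]]].
      by exists p; rewrite inE eqxx.
    by exists q; rewrite inE qt orbT.
  exists t; split=> // J iJ JI tJ; apply: ugen; first exact: Lid.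
  by move=> x /tu[p [/tJ Jp sp pd]]; exists p.
have [t [tI tgen]] : exists t : seq {poly A}, (forall p, p \in t -> I p) /\
    forall J, is_ideal J -> J `<=` I -> (forall p, p \in t -> J p) ->
      forall d, (d <= D)%N -> L I d `<=` L J d.
  elim: {LD sD} D => [|D [t [tI tgen]]].
    have [t [tI tgen]] := gen1 0%N; exists t; split=> // J iJ JI tJ d.
    by rewrite leqn0 => /eqP ->; apply: tgen.
  have [u [uI ugen]] := gen1 D.+1; exists (t ++ u); split=> [p|J iJ JI tJ d].
    by rewrite mem_cat => /orP[/tI|/uI].
  rewrite leq_eqVlt => /predU1P[->|dD].
    by apply: ugen => // p pu; apply: tJ; rewrite mem_cat pu orbT.
  by apply: tgen => // p pt; apply: tJ; rewrite mem_cat pt.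
exists t; split=> // J iJ tJ.
have iIJ : is_ideal (I `&` J).
  have [J0 JD JM] := iJ; split=> [//|x y [Ix Jx] [Iy Jy]|a x [Ix Jx]].
    by split; [apply: ID|apply: JD].
  by split; [apply: IM|apply: JM].
have tgen' := tgen (I `&` J) iIJ (fun _ H => H.1) (fun p pt => conj (tI p pt) (tJ p pt)).
move=> p; have [N] := ubnP (size p); elim: N p => // N IH p; rewrite ltnS => sp Ip.
have [->|pn0] := eqVneq p 0; first by case: iJ.
have spS : size p = (size p).-1.+1 by rewrite prednK// size_poly_gt0.
set d := (size p).-1 in spS *.
have Lp : L I d p`_d by exists p; rewrite spS.
(* Above degree [D] the leading coefficient is already realised in degree [D], and the polynomial
   found there is shifted by a power of ['X]. *)
pose e := minn d D; have ed : (e <= d)%N by rewrite geq_minl.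
have Lep : L I e p`_d by rewrite /e /minn; case: ifP => // _; apply: LD Lp.
have [q [[Iq Jq] sq qe]] := tgen' e (geq_minr _ _) _ Lep.
have [J0 JD JM] := iJ.
rewrite -(subrK ('X^(d - e) * q) p); apply: JD; last exact: JM.
apply: IH; last by apply: is_idealB => //; apply: IM.
apply: leq_trans (sp); rewrite spS ltnS; apply/leq_sizeP => j.
rewrite leq_eqVlt coefB coefXnM => /predU1P[<-|dj].
  by rewrite ltnNge leq_subr /= subKn// qe subrr.
rewrite [p`_j]nth_default ?spS// sub0r; case: ifP => _; first by rewrite oppr0.
rewrite nth_default ?oppr0// (leq_trans sq)//.
by rewrite ltn_subRL subnK.
Qed.

(** Induction on [n]: evaluation at the last variable maps [{poly mpoly n K}] onto
    [mpoly n.+1 K]. *)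
Lemma noetherian_mpoly (K : fieldType) (n : nat) : noetherian (mpoly n K).
Proof.
elim: n => [|n IH].
  apply: (noetherian_surj (h := @mpolyC 0 K)); last exact: noetherian_field.
  apply: mpoly_ring_ind => [c|[]//|_ _ [a <-] [b <-]|_ _ [a <-] [b <-]].
  - by exists c.
  - by exists (a + b); rewrite rmorphD.
  - by exists (a * b); rewrite rmorphM.
pose h : {rmorphism {poly mpoly n K} -> mpoly n.+1 K} :=
  horner_eval ('X_ord_max : mpoly n.+1 K) \o map_poly (@mwiden n K).
apply: (noetherian_surj (h := h)); last exact: noetherian_poly.
apply: mpoly_ring_ind => [c|i|_ _ [a <-] [b <-]|_ _ [a <-] [b <-]].
- by exists (mpolyC n c)%:P; rewrite /h /= map_polyC /= /horner_eval hornerC mwidenC.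
- have [->|/eqP im] := eqVneq i ord_max.
    by exists 'X; rewrite /h /= map_polyX /horner_eval hornerX.
  have lt : (i < n)%N.
    have := ltn_ord i; rewrite ltnS leq_eqVlt => /predU1P[e|//].
    by case: im; apply: val_inj.
  exists ('X_(Ordinal lt))%:P; rewrite /h /= map_polyC /= /horner_eval hornerC mwidenX.
  rewrite mnmwiden1; congr mpolyX; congr mnm1; exact: val_inj.
- by exists (a + b); rewrite rmorphD.
- by exists (a * b); rewrite rmorphM.
Qed.

(** Without a maximal member, choice produces a strictly increasing sequence; its union is a
    finitely generated ideal, hence contained in one of its terms. *)
Lemma noetherian_max (A : comNzRingType) (Fam : set (set A)) :
  noetherian A -> (forall I, Fam I -> is_ideal I) -> Fam !=set0 ->
  exists2 I, Fam I & forall J, Fam J -> I `<=` J -> J `<=` I.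
Proof.
move=> nA idF [I0 FI0]; apply: contrapT => nomax.
have step (I : {I | Fam I}) :
    exists J : {J | Fam J}, sval I `<=` sval J /\ ~ sval J `<=` sval I.
  case: I => I FI /=; apply: contrapT => noJ; apply: nomax; exists I => // J FJ IJ.
  by apply: contrapT => nJI; apply: noJ; exists (exist _ J FJ).
have [g gP] := choice step.
pose u k := sval (iter k g (exist _ I0 FI0)).
have uS k : u k `<=` u k.+1 by have [] := gP (iter k g (exist _ I0 FI0)).
have unS k : ~ u k.+1 `<=` u k by have [] := gP (iter k g (exist _ I0 FI0)).
have uid k : is_ideal (u k) by apply: idF; rewrite /u; case: (iter _ _ _).
have ule k l : (k <= l)%N -> u k `<=` u l.
  move=> /subnK <-; elim: (l - k)%N => // m IH x /IH; rewrite addSn; exact: uS.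
have [|s [su sgen]] := nA [set x | exists k, u k x].
  split; first by exists 0%N; have [] := uid 0%N.
  - move=> x y [k ux] [l uy]; exists (maxn k l); have [_ UD _] := uid (maxn k l).
    by apply: UD; [apply: (ule k); rewrite ?leq_maxl|apply: (ule l); rewrite ?leq_maxr].
  - by move=> a x [k ux]; exists k; have [_ _] := uid k; apply.
have [k uk] : exists k, forall x, x \in s -> u k x.
  elim: s su {sgen} => [|x s IH] su; first by exists 0%N.
  have [|k uk] := IH; first by move=> y ys; apply: su; rewrite inE ys orbT.
  have [|l ul] := su x; first by rewrite inE eqxx.
  exists (maxn k l) => y; rewrite inE => /predU1P[->|/uk].
    by apply: ule ul; rewrite leq_maxr.
  by apply: ule; rewrite leq_maxl.
apply: (unS k) => x ux; apply: (sgen _ (uid k) uk); by exists k.+1.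
Qed.

(** * Vanishing ideals of point sets and polynomial vector fields *)

Section vanishing_ideals.
Variables (R : realType) (n : nat).
Implicit Types (Y Z S : set 'rV[R]_n) (F G : mpoly n R) (x : 'rV[R]_n).

Definition pev x F : R := meval (x 0) F.

Lemma pevD x F G : pev x (F + G) = pev x F + pev x G. Proof. exact: mevalD. Qed.
Lemma pevB x F G : pev x (F - G) = pev x F - pev x G. Proof. exact: mevalB. Qed.
Lemma pevN x F : pev x (- F) = - pev x F. Proof. exact: mevalN. Qed.
Lemma pevM x F G : pev x (F * G) = pev x F * pev x G. Proof. exact: mevalM. Qed.
Lemma pevC x c : pev x (mpolyC n c) = c. Proof. exact: mevalC. Qed.
Lemma pev0 x : pev x 0 = 0. Proof. exact: meval0. Qed.
Lemma pev1 x : pev x 1 = 1. Proof. exact: meval1. Qed.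
Lemma pevX x i : pev x 'X_i = x 0 i. Proof. exact: mevalXU. Qed.
Lemma pev_sum x (T : finType) (F : T -> mpoly n R) :
  pev x (\sum_i F i) = \sum_i pev x (F i).
Proof. exact: raddf_sum. Qed.
Definition pevE := (pevD, pevB, pevN, pevM, pevC, pev0, pev1, pevX, pev_sum).

Lemma vanishing_is_ideal Y : is_ideal (vanishing_ideal Y).
Proof.
split=> [x _|F G YF YG x Yx|F G YG x Yx]; first exact: meval0.
  by rewrite mevalD YF// YG// addr0.
by rewrite mevalM YG// mulr0.
Qed.

Lemma vanishing_sub Y Z : Y `<=` Z -> vanishing_ideal Z `<=` vanishing_ideal Y.
Proof. by move=> YZ F ZF x /YZ; apply: ZF. Qed.

Definition is_prime (I : set (mpoly n R)) : Prop :=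
  [/\ is_ideal I, ~ I 1 & forall F G, I (F * G) -> I F \/ I G].

(* A family of sets which is "prime" for unions has a member whose vanishing
   ideal is prime and is not enlarged by passing to a smaller member: take a
   maximal vanishing ideal. *)
Lemma exists_prime_vanishing (Fam : set (set 'rV[R]_n)) :
  Fam !=set0 -> ~ Fam set0 ->
  (forall Y Z, Fam (Y `|` Z) -> Fam Y \/ Fam Z) ->
  exists Y, [/\ Fam Y, is_prime (vanishing_ideal Y) &
    forall Z, Fam Z -> Z `<=` Y -> vanishing_ideal Z `<=` vanishing_ideal Y].
Proof.
move=> [Y0 FY0] F0 FU.
have [I [Y [FY ->]] Ymax] := @noetherian_max _
    [set I | exists Y, Fam Y /\ I = vanishing_ideal Y] (@noetherian_mpoly R n) 
    ltac:(by move=> _ [Y [_ ->]]; exact: vanishing_is_ideal)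
    ltac:(by exists (vanishing_ideal Y0), Y0).
have {}Ymax Z : Fam Z -> Z `<=` Y -> vanishing_ideal Z `<=` vanishing_ideal Y.
  by move=> FZ ZY; apply: Ymax; [exists Z|exact: vanishing_sub].
exists Y; split=> //; split; first exact: vanishing_is_ideal.
  move=> Y1; apply: F0; suff <- : Y = set0 by [].
  by apply/seteqP; split=> // x /Y1; rewrite meval1 => /eqP; rewrite oner_eq0.
move=> F G YFG.
have : Fam ((Y `&` [set x | pev x F = 0]) `|` (Y `&` [set x | pev x G = 0])).
  suff <- : Y = (Y `&` [set x | pev x F = 0]) `|` (Y `&` [set x | pev x G = 0]) by [].
  apply/seteqP; split=> [x Yx|x [] []//].
  have /eqP := YFG _ Yx; rewrite mevalM mulf_eq0 => /orP[]/eqP; first by left.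
  by right.
by case/FU => FZ; [left|right]; apply: (Ymax _ FZ) => x [].
Qed.

Lemma infinite_setU (T : Type) (A B : set T) :
  infinite_set (A `|` B) -> infinite_set A \/ infinite_set B.
Proof.
move=> AB; have [fA|] := pselect (finite_set A); last by left.
by right=> fB; apply: AB; rewrite finite_setU.
Qed.

(** Pigeonhole over the finitely many roots of [p], which are split off one at a time. *)
Lemma infinite_root_fiber S (p : {poly R}) (i : 'I_n) :
  p != 0 -> infinite_set S -> (forall s, S s -> root p (s 0 i)) ->
  exists c, infinite_set (S `&` [set s | s 0 i = c]).
Proof.
have [N] := ubnP (size p); elim: N p S => // N IH p S; rewrite ltnS => sp pn0 iS rS.
have [s Ss] : S !=set0.
  by apply/set0P/eqP => S0; apply: iS; rewrite S0; exact: finite_set0.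
have [q qE] := factor_theorem _ _ (rS _ Ss).
have qn0 : q != 0 by apply: contraNneq pn0 => q0; rewrite qE q0 mul0r.
have sq : size p = (size q).+1.
  by rewrite qE size_Mmonic ?monicXsubC// size_XsubC addn2.
have : infinite_set ((S `&` [set t | t 0 i = s 0 i]) `|`
                     (S `&` [set t | t 0 i <> s 0 i])).
  suff <- : S = (S `&` [set t | t 0 i = s 0 i]) `|`
                     (S `&` [set t | t 0 i <> s 0 i]) by [].
  apply/seteqP; split=> [t St|t [] []//].
  by have [/eqP|/eqP] := boolP (t 0 i == s 0 i); [left|right].
case/infinite_setU => [|iS2]; first by exists (s 0 i).
have [||c ic] := IH q _ _ qn0 iS2; first by rewrite -sq.
  move=> t [St /eqP ts]; have := rS _ St.
  by rewrite qE rootM root_XsubC (negPf ts) orbF.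
by exists c => fc; apply: ic; apply: sub_finite_set fc => t [[St _] tc].
Qed.

Definition vfield (e : 'I_n -> mpoly n R) F : mpoly n R :=
  \sum_j e j * mderiv j F.

Lemma vfieldD e F G : vfield e (F + G) = vfield e F + vfield e G.
Proof. by rewrite /vfield -big_split; apply: eq_bigr => j _; rewrite mderivD mulrDr. Qed.

Lemma vfieldM e F G : vfield e (F * G) = vfield e F * G + F * vfield e G.
Proof.
rewrite /vfield mulr_suml mulr_sumr -big_split; apply: eq_bigr => j _ /=.
by rewrite mderivM; ring.
Qed.

Lemma vfieldC e c : vfield e (mpolyC n c) = 0.
Proof. by rewrite /vfield big1// => j _; rewrite mderivC mulr0. Qed.

Lemma vfield0 e : vfield e 0 = 0.
Proof. by rewrite -mpolyC0 vfieldC. Qed.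

Lemma mderivXU (i j : 'I_n) : mderiv j ('X_i : mpoly n R) = (i == j)%:R.
Proof.
rewrite mderivX mnm1E; case: eqP => [->|_]; last by rewrite scale0r.
rewrite scale1r -mpolyX0; congr mpolyX; apply/mnmP => k.
by rewrite mnmBE subnn mnm0E.
Qed.

Lemma vfieldX e i : vfield e 'X_i = e i.
Proof.
rewrite /vfield (bigD1 i)//= mderivXU eqxx mulr1 big1 ?addr0// => j ji.
by rewrite mderivXU eq_sym (negPf ji) mulr0.
Qed.

(** The product rule separates the action on the coefficients from the action on [x], which is what
    allows a derivation to be extended by one variable. *)
Lemma vfield_horner e (p : {poly mpoly n R}) (x : mpoly n R) :
  vfield e p.[x] = \sum_(k < size p) vfield e p`_k * x ^+ k + p^`().[x] * vfield e x.
Proof.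
have vX k : vfield e (x ^+ k) = x ^+ k.-1 *+ k * vfield e x.
  elim: k => [|k IH]; first by rewrite expr0 -mpolyC1 vfieldC mulr0n mul0r.
  rewrite exprS vfieldM IH; case: k {IH} => [|k] /=; first by rewrite !expr0; ring.
  by rewrite exprS [in RHS]mulrS -mulr_natr -[in RHS]mulr_natr; ring.
rewrite horner_coef (big_morph _ (vfieldD e) (vfield0 e)).
have -> : p^`().[x] = \sum_(k < size p) p`_k * (x ^+ k.-1 *+ k).
  rewrite -{1}[p]coefK poly_def raddf_sum horner_sum; apply: eq_bigr => k _ /=.
  by rewrite derivZ derivXn hornerZ hornerMn hornerXn.
rewrite mulr_suml -big_split; apply: eq_bigr => k _ /=.
by rewrite vfieldM vX mulrA.
Qed.
End vanishing_ideals.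

(** * Derivations preserving a prime ideal *)

Section derivations.
Variables (R : realType) (n : nat).
Implicit Types (F G : mpoly n R) (x y : 'rV[R]_n) (i j : 'I_n).

(* The polynomials in the first k variables. *)
Fixpoint tower (k : nat) : set (mpoly n R) :=
  if k is k'.+1 then
    [set F | exists2 p : {poly mpoly n R}, (forall l, tower k' p`_l) &
      F = p.[if (insub k' : option 'I_n) is Some i then 'X_i else 0]]
  else [set mpolyC n c | c in [set: R]].

Lemma towerC k c : tower k (mpolyC n c).
Proof.
elim: k c => [|k IH] c /=; first by exists c.
exists (mpolyC n c)%:P; last by rewrite hornerC.
by move=> l; rewrite coefC; case: eqP => _ //; rewrite -mpolyC0.
Qed.

Lemma towerD k F G : tower k F -> tower k G -> tower k (F + G).
Proof.
elim: k F G => [|k IH] F G /=.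
  by move=> [a _ <-] [b _ <-]; exists (a + b); rewrite ?mpolyCD.
move=> [p pT ->] [q qT ->]; exists (p + q); last by rewrite hornerD.
by move=> l; rewrite coefD; apply: IH.
Qed.

Lemma towerM k F G : tower k F -> tower k G -> tower k (F * G).
Proof.
elim: k F G => [|k IH] F G /=.
  by move=> [a _ <-] [b _ <-]; exists (a * b); rewrite ?mpolyCM.
move=> [p pT ->] [q qT ->]; exists (p * q); last by rewrite hornerM.
move=> l; rewrite coefM; apply: (big_ind (tower k)).
- by rewrite -mpolyC0; exact: towerC.
- by move=> ? ?; exact: towerD.
- by move=> m _; exact: IH.
Qed.

Lemma towerB k F G : tower k F -> tower k G -> tower k (F - G).
Proof.
move=> FT GT; rewrite -mulN1r; apply: towerD => //; apply: towerM => //.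
by rewrite -mpolyC1 -mpolyCN; exact: towerC.
Qed.

Lemma towerS k F : tower k F -> tower k.+1 F.
Proof.
move=> FT; exists F%:P; last by rewrite hornerC.
by move=> l; rewrite coefC; case: eqP => _ //; rewrite -mpolyC0; exact: towerC.
Qed.

Lemma towerX k i : (i < k)%N -> tower k 'X_i.
Proof.
elim: k => // k IH; rewrite ltnS leq_eqVlt => /predU1P[ik|/IH]; last exact: towerS.
exists 'X; last by rewrite hornerX -ik valK.
by move=> l; rewrite coefX; case: eqP => _; rewrite -?mpolyC1 -?mpolyC0; exact: towerC.
Qed.

Lemma tower_all F : tower n F.
Proof.
elim/(@mpoly_ring_ind R n): F => [c|i|F G|F G].
- exact: towerC.
- exact: towerX.
- exact: towerD.
- exact: towerM.
Qed.

Lemma tower_mderiv k j F : (k <= j)%N -> tower k F -> mderiv j F = 0.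
Proof.
have vfE G : mderiv j G = vfield (fun i => (i == j)%:R) G.
  rewrite /vfield (bigD1 j)//= eqxx mul1r big1 ?addr0// => i /negPf ->.
  by rewrite mul0r.
elim: k F => [|k IH] F /= kj; first by case=> c _ <-; rewrite mderivC.
case=> p pT ->; rewrite vfE vfield_horner big1 ?add0r => [|l _].
  case: insubP => [i _ ik|_]; last by rewrite vfield0 mulr0.
  by rewrite vfieldX -val_eqE /= ik (ltn_eqF kj) mulr0.
by rewrite -vfE IH ?mul0r// ltnW.
Qed.

Lemma tower_pev k x y F : (forall i, (i < k)%N -> x 0 i = y 0 i) ->
  tower k F -> pev x F = pev y F.
Proof.
elim: k F => [|k IH] F /= xy; first by case=> c _ <-; rewrite !pevC.
case=> p pT ->; rewrite !horner_coef !pev_sum; apply: eq_bigr => l _.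
rewrite !pevM (IH _ _ (pT l)); last by move=> i ik; apply: xy; rewrite ltnS ltnW.
congr (_ * _); rewrite /pev !rmorphXn; congr (_ ^+ _).
case: insubP => [i _ ik|_]; last by rewrite !rmorph0.
by rewrite /= !mevalXU xy// ik.
Qed.

Lemma is_prime_const (I : set (mpoly n R)) c : is_prime I -> I (mpolyC n c) -> c = 0.
Proof.
move=> [[_ _ IM] I1 _] Ic; apply/eqP; apply: contrapT => /negP cn0; apply: I1.
by rewrite -mpolyC1 -(mulVf cn0) mpolyCM; apply: IM.
Qed.

(* An ideal [I] which is prime and whose zero set is infinite is preserved by a
   vector field which does not vanish identically modulo [I].  It is extended
   one variable at a time: over an algebraic variable [x] with minimal relation
   [M x = 0] the derivation [D] of the coefficients extends, after
   multiplication by [M' x], with [x |-> - (D M) x]. *)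
Section preserving_field.
Variable (S : set 'rV[R]_n).
Let I := vanishing_ideal S.
Hypotheses (Sinf : infinite_set S) (Ip : is_prime I).
Hypothesis Smin : forall Z, infinite_set Z -> Z `<=` S -> vanishing_ideal Z `<=` I.

Section one_variable.
Variables (k : nat) (i : 'I_n) (ik : i = k :> nat).
Let x : mpoly n R := 'X_i.
Let coefT (p : {poly mpoly n R}) := forall l, tower k p`_l.

Lemma coefTB p q : coefT p -> coefT q -> coefT (p - q).
Proof. by move=> pT qT l; rewrite coefB; apply: towerB. Qed.

Lemma coefTmon a m p : tower k a -> coefT p -> coefT (a%:P * 'X^m * p).
Proof.
move=> aT pT l; rewrite -mulrA coefCM; apply: towerM => //; rewrite coefXnM.
by case: ifP => _ //; rewrite -mpolyC0; exact: towerC.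
Qed.

(** One step of pseudo-division: the coefficients cannot be divided, so the leading ones are
    cross-multiplied. *)
Lemma size_cancel (p q : {poly mpoly n R}) : p != 0 -> (size q <= size p)%N -> q != 0 ->
  (size (lead_coef q *: p - (lead_coef p)%:P * 'X^(size p - size q)%N * q)%R < size p)%N.
Proof.
move=> pn0 sqp qn0.
have sp : (0 < size p)%N by rewrite size_poly_gt0.
have sq : (0 < size q)%N by rewrite size_poly_gt0.
have [h1 h2] : (size p - size q <= (size p).-1)%N /\
    ((size p).-1 - (size p - size q) = (size q).-1)%N.
  by move: sp sq sqp; move: (size p) (size q) => a b; lia.
have [h3 h4] : (forall j : nat, (size p).-1 < j -> size p <= j)%N /\
    (forall j : nat, (size p).-1 < j -> size q <= j - (size p - size q))%N.
  by move: sp sq sqp; move: (size p) (size q) => a b; split=> j; lia.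
rewrite -{2}(prednK sp) ltnS; apply/leq_sizeP => j; rewrite leq_eqVlt => /predU1P[<-|pj].
  rewrite coefB coefZ -mulrA coefCM coefXnM ltnNge h1 /= h2.
  by rewrite /lead_coef mulrC subrr.
rewrite coefB coefZ -mulrA coefCM coefXnM nth_default; last exact: h3.
case: ifP => _; first by rewrite !mulr0 subrr.
by rewrite [q`__]nth_default ?mulr0 ?subr0//; exact: h4.
Qed.

(** A leading term lying in [I] can be stripped: what remains is a shorter relation. *)
Lemma coef_in_ideal d :
  (forall M, coefT M -> I M.[x] -> (size M < d)%N -> I (lead_coef M)) ->
  forall p, coefT p -> I p.[x] -> (size p < d)%N -> forall l, I p`_l.
Proof.
have [iI _ _] := Ip; have [I0 ID IM] := iI.
move=> Md p; have [N] := ubnP (size p); elim: N p => // N IH p.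
rewrite ltnS => sp pT Ip' spd l.
have [->|pn0] := eqVneq p 0; first by rewrite coef0.
have Il := Md p pT Ip' spd.
(* The factor 1 gives [q] the form of a pseudo-division by the constant polynomial 1. *)
pose q := p - (lead_coef p)%:P * 'X^((size p).-1) * 1.
have q1T : coefT 1.
  by move=> m; rewrite coef1; case: eqP => _; rewrite -?mpolyC1 -?mpolyC0; exact: towerC.
have qT : coefT q.
  by apply: coefTB => //; apply: (@coefTmon (lead_coef p) (size p).-1 1) => //; exact: pT.
have sq : (size q < size p)%N.
  have := @size_cancel p 1 pn0; rewrite lead_coef1 scale1r size_poly1 subn1; apply=> //.
    by rewrite size_poly_gt0.
  exact: oner_neq0.
have Iq : I q.[x].
  rewrite /q hornerD hornerN !hornerM hornerC; apply: (is_idealB iI) => //.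
  by rewrite -mulrA mulrC; apply: IM.
have -> : p = q + (lead_coef p)%:P * 'X^((size p).-1) * 1 by rewrite /q subrK.
rewrite coefD mulr1 coefCM coefXn; apply: ID.
  by apply: IH => //; [exact: leq_trans sq sp|exact: ltn_trans sq spd].
by rewrite mulrC; apply: IM.
Qed.

Lemma vfield_upd e c w F : tower k F ->
  vfield (fun j => if j == i then w else c * e j) F = c * vfield e F.
Proof.
move=> FT; rewrite /vfield mulr_sumr; apply: eq_bigr => j _.
case: eqP => [->|_]; last by rewrite mulrA.
by rewrite (tower_mderiv _ FT) ?mulr0// ik.
Qed.

(** When the variable is transcendental modulo [I], a relation has all its coefficients in [I], so
    the image [w] of the variable can be arbitrary. *)
Lemma extend_transcendental e :
  (forall p, coefT p -> I p.[x] -> forall l, I p`_l) ->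
  (forall F, tower k F -> I F -> I (vfield e F)) -> forall c w,
  forall F, tower k.+1 F -> I F ->
    I (vfield (fun j => if j == i then w else c * e j) F).
Proof.
have [iI _ _] := Ip; have [I0 ID IM] := iI.
move=> tr eI c w _ [p pT ->]; rewrite -ik valK => Ip'.
rewrite vfield_horner; apply: ID.
  apply: (is_ideal_sum iI) => // l; rewrite vfield_upd; last exact: pT.
  rewrite mulrC; apply: (IM); apply: IM; apply: eI; first exact: pT.
  exact: tr.
rewrite mulrC; apply: (IM); rewrite horner_coef; apply: (is_ideal_sum iI) => // l.
rewrite mulrC coef_deriv -mulr_natl; apply: (IM); apply: IM; exact: tr.
Qed.

(** [M] is a relation of least size. The new field annihilates [M.[x]] exactly; any other relation
    is brought below the size of [M] by pseudo-division, where all coefficients lie in [I], and the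
    factor [lead_coef M] is cancelled by primality. *)
Lemma extend_algebraic e M :
  (forall F, tower k F -> I F -> I (vfield e F)) ->
  coefT M -> I M.[x] ->
  ~ I (lead_coef M) ->
  (forall N, coefT N -> I N.[x] -> (size N < size M)%N -> I (lead_coef N)) ->
  exists c w, ~ I c /\ forall F, tower k.+1 F -> I F ->
    I (vfield (fun j => if j == i then w else c * e j) F).
Proof.
have [iI I1 IP] := Ip; have [I0 ID IM] := iI.
move=> eI MT IMx Ml Mmin.
pose c := M^`().[x]; pose w := - \sum_(l < size M) vfield e M`_l * x ^+ l.
exists c, w.
have Mn0 : M != 0 by apply: contra_notN Ml => /eqP ->; rewrite lead_coef0.
have sM : (1 < size M)%N.
  rewrite ltnNge; apply/negP => sM; apply: Ml; move: IMx.
  by rewrite (size1_polyC sM) hornerC lead_coefC.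
(* The derivative of [M] is shorter than [M], so a value in [I] would put its coefficients in [I];
   the top one is a nonzero integer times [lead_coef M]. *)
have Ic : ~ I c.
  move=> Ic; apply: Ml.
  have sd : (size M^`() < size M)%N by exact: lt_size_deriv.
  have dT : coefT M^`().
    move=> l; rewrite coef_deriv -mulr_natl; apply: towerM => //.
    by rewrite -mpolyC_nat; exact: towerC.
  have := coef_in_ideal Mmin dT Ic sd (size M).-2.
  rewrite coef_deriv (_ : (size M).-2.+1 = (size M).-1); last by lia.
  rewrite -mulr_natl -mpolyC_nat => /IP[/(is_prime_const Ip)/eqP|//].
  by rewrite pnatr_eq0; lia.
split=> // _ [p pT ->]; rewrite -ik valK => Ip'.
set D := vfield _.
have DM : D M.[x] = 0.
  rewrite /D vfield_horner vfieldX eqxx /w.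
  under eq_bigr do rewrite vfield_upd// -mulrA.
  by rewrite -mulr_sumr -/c; ring.
have [N] := ubnP (size p); elim: N p pT Ip' => // N IH p pT Ip'; rewrite ltnS => sp.
have [spM|sMp] := ltnP (size p) (size M).
  have pI := coef_in_ideal Mmin pT Ip' spM.
  rewrite /D vfield_horner; apply: ID.
    apply: (is_ideal_sum iI) => // l; rewrite vfield_upd; last exact: pT.
    by rewrite mulrC; apply: (IM); apply: IM; apply: eI; [exact: pT|].
  rewrite mulrC; apply: (IM); rewrite horner_coef; apply: (is_ideal_sum iI) => // l.
  by rewrite mulrC coef_deriv -mulr_natl; apply: (IM); apply: IM.
have pn0 : p != 0 by rewrite -size_poly_gt0 (leq_trans _ sMp)// size_poly_gt0.
set t := (lead_coef p)%:P * 'X^(size p - size M)%N.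
pose q := lead_coef M *: p - t * M.
have qT : coefT q.
  apply: coefTB; last by apply: (@coefTmon (lead_coef p) (size p - size M) M) => //; exact: pT.
  by move=> l; rewrite coefZ; apply: towerM; [exact: MT|exact: pT].
have qE : q.[x] = lead_coef M * p.[x] - t.[x] * M.[x].
  by rewrite hornerD hornerN hornerZ hornerM.
have IqM : I (lead_coef M * p.[x]) by apply: IM.
have Iq : I (D q.[x]).
  apply: IH => //; first by rewrite qE; apply: (is_idealB iI) => //; apply: IM.
  exact: leq_trans (size_cancel pn0 sMp Mn0) sp.
have DpE : lead_coef M * D p.[x] =
    D q.[x] + (D t.[x] * M.[x]) - p.[x] * D (lead_coef M).
  have e1 : lead_coef M * p.[x] = q.[x] + t.[x] * M.[x] by rewrite qE subrK.
  have := congr1 D e1; rewrite /D vfieldM vfieldD vfieldM -/D DM mulr0 addr0 => <-.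
  by ring.
have : I (lead_coef M * D p.[x]).
  rewrite DpE; apply: (is_idealB iI) => //.
    by apply: ID => //; apply: IM.
  by rewrite mulrC; apply: IM.
by case/IP.
Qed.

(** As the first [k] coordinates are constant, the coefficients of [M] are numbers on [S], and the
    next coordinate takes finitely many values. It is constant on an infinite subset, hence on [S]
    by [Smin]. *)
Lemma algebraic_const M s0 : S s0 -> coefT M -> I M.[x] -> ~ I (lead_coef M) ->
  (forall s j, S s -> (j < k)%N -> s 0 j = s0 0 j) ->
  exists c, I (x - mpolyC n c).
Proof.
move=> Ss0 MT IMx Ml sc.
have evc F s : S s -> tower k F -> pev s F = pev s0 F.
  by move=> Ss; apply: tower_pev => j jk; apply: sc.
pose Mb := map_poly (pev s0) M.
have pevh s : S s -> pev s M.[x] = Mb.[s 0 i].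
  move=> Ss; rewrite horner_coef pev_sum.
  have -> : Mb = \poly_(l < size M) pev s0 M`_l by [].
  rewrite horner_poly; apply: eq_bigr => l _.
  by rewrite pevM (evc _ _ Ss (MT l)) /pev rmorphXn /= mevalXU.
have Mbn0 : Mb != 0.
  apply: contra_notN Ml => /eqP Mb0 s Ss; rewrite -/(pev s _) (evc _ _ Ss (MT _)).
  have := congr1 (fun p : {poly R} => p`_(size M).-1) Mb0.
  by rewrite coef0 coef_map_id0// pev0.
have [|c ic] := @infinite_root_fiber _ _ S Mb i Mbn0 Sinf.
  by move=> s Ss; apply/eqP; rewrite -pevh//; apply: IMx.
exists c; apply: (Smin ic) => [s []//|s [_ /= sc']].
by rewrite -/(pev s _) pevB pevX pevC sc' subrr.
Qed.
End one_variable.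

Lemma preserving_vfield : exists e : 'I_n -> mpoly n R,
  (forall F, I F -> I (vfield e F)) /\ exists j, ~ I (e j).
Proof.
have [iI I1 IP] := Ip; have [I0 ID IM] := iI.
have [s0 Ss0] : S !=set0.
  by apply/set0P/eqP => S0; apply: Sinf; rewrite S0; exact: finite_set0.
(* Dichotomy by induction on [k]: either the first [k] coordinates are constant on [S], or a field
   with a nonzero component among them preserves the part of [I] in these variables. *)
have : forall k, (k <= n)%N ->
   (forall j : 'I_n, (j < k)%N -> exists c, I ('X_j - mpolyC n c)) \/
   exists e, (forall F, tower k F -> I F -> I (vfield e F)) /\
             exists j : 'I_n, (j < k)%N /\ ~ I (e j).
  elim => [|k IH] kn; first by left.
  pose i := Ordinal kn.
  pose alg d := exists M : {poly mpoly n R}, [/\ forall l, tower k M`_l, I M.['X_i],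
    ~ I (lead_coef M) & size M = d].
  have [[d algd]|noalg] := pselect (exists d, alg d).
    have ex : exists d, `[< alg d >] by exists d; apply/asboolP.
    case: (ex_minnP ex) => {algd}d /asboolP[M [MT IMx Ml sM]] dmin.
    have Mmin (N : {poly mpoly n R}) : (forall l, tower k N`_l) -> I N.['X_i] -> (size N < size M)%N ->
        I (lead_coef N).
      move=> NT INx sN; apply: contrapT => Nl.
      have /dmin : `[< alg (size N) >] by apply/asboolP; exists N.
      by rewrite -sM leqNgt sN.
    case: (IH (ltnW kn)) => [con|[e [eI [j [jk Ij]]]]]; [left|right].
      move=> j; rewrite ltnS leq_eqVlt => /predU1P[jk|/con//].
      have -> : j = i by exact: val_inj.
      apply: (@algebraic_const k i M s0) => // s j' Ss /con[c Ic].
      have := Ic _ Ss; have := Ic _ Ss0; rewrite -/(pev s _) -/(pev s0 _) !pevE => h1 h2.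
      by apply/eqP; rewrite -subr_eq0; apply/eqP; lra.
    have [c [w [Icc cw]]] := @extend_algebraic k i (erefl _) e M eI MT IMx Ml Mmin.
    exists (fun j => if j == i then w else c * e j); split=> //.
    exists j; split; first by rewrite ltnS ltnW.
    by rewrite -val_eqE /= (ltn_eqF jk) => /IP[].
  have tr (p : {poly mpoly n R}) : (forall l, tower k p`_l) -> I p.['X_i] ->
      forall l, I p`_l.
    move=> pT Ip'; refine (@coef_in_ideal k i (erefl _) (size p).+1 _ p pT Ip' (ltnSn _)).
    by move=> M MT IMx _; apply: contrapT => Ml; apply: noalg; exists (size M), M.
  right; case: (IH (ltnW kn)) => [_|[e [eI [j [jk Ij]]]]].
    (* Constant coordinates followed by a transcendental one: the field starts as the partial
       derivative in that variable. *)
    exists (fun j => if j == i then 1 else 1 * (fun=> 0) j); split; last first.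
      by exists i; rewrite eqxx.
    apply: extend_transcendental => // F _ _.
    by rewrite /vfield big1// => j _; rewrite mul0r.
  exists (fun j => if j == i then 0 else 1 * e j); split; last first.
    by exists j; rewrite ltnS ltnW// -val_eqE /= (ltn_eqF jk) mul1r.
  exact: extend_transcendental.
case/(_ n (leqnn n)) => [con|[e [eI [j [_ Ij]]]]]; last first.
  by exists e; split; [move=> F; apply: eI; exact: tower_all|exists j].
(* If all coordinates were constant, [S] would be a single point. *)
case: Sinf; apply: (@sub_finite_set _ _ [set s0]); last exact: finite_set1.
move=> s Ss /=; apply/rowP => j; have [c Ic] := con j (ltn_ord j).
have := Ic _ Ss; have := Ic _ Ss0; rewrite -/(pev s _) -/(pev s0 _) !pevE => h1 h2.
by apply/eqP; rewrite -subr_eq0; apply/eqP; lra.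
Qed.

(** The field [e] sends each [Phi i] into [I], so the gradient matrix kills [e] modulo [I]; by
    Cramer's rule its determinant times a component outside [I] lies in [I]. *)
Lemma det_gradient_in_ideal (Phi : 'I_n -> mpoly n R) : (forall i, I (Phi i)) ->
  I (\det (\matrix_(i, j) mderiv j (Phi i))).
Proof.
have [iI I1 IP] := Ip; have [I0 ID IM] := iI.
move=> PhiI; have [e [eI [j Ij]]] := preserving_vfield.
set A := \matrix_(_, _) _.
pose v : 'cV[mpoly n R]_n := \col_k e k.
have AvI i : I ((A *m v) i 0).
  have := eI _ (PhiI i); rewrite /vfield mxE; congr (I _).
  by apply: eq_bigr => l _; rewrite !mxE mulrC.
have : \det A * e j = \sum_l \adj A j l * (A *m v) l 0.
  have := congr1 (fun B => (B *m v) j 0) (mul_adj_mx A).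
  by rewrite /= -mulmxA mul_scalar_mx !mxE => ->.
move=> dE; have : I (\det A * e j).
  by rewrite dE; apply: (is_ideal_sum iI) => // l; apply: IM.
by case/IP.
Qed.
End preserving_field.
End derivations.

(** * Calculus of polynomial maps *)

Section polynomial_calculus.
Variables (R : realType) (n : nat).
Implicit Types (F G : mpoly n R) (x y p v : 'rV[R]_n).

Lemma rV_norm_entry m (x : 'rV[R]_m) i : `|x 0 i| <= `|x|.
Proof.
by rewrite [leRHS]/Num.norm /= mx_normrE; apply/bigmax_geP; right => /=; exists (0, i).
Qed.

Lemma rV_norm_le m (x : 'rV[R]_m) c :
  0 <= c -> (forall i, `|x 0 i| <= c) -> `|x| <= c.
Proof.
move=> c0 xc; rewrite [leLHS]/Num.norm /= mx_normrE; apply/bigmax_leP; split=> // -[i j] _ /=.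
by rewrite (ord1 i).
Qed.

Lemma rV_mulmx_bound m k (B : 'M[R]_(m, k)) :
  exists2 C, 0 <= C & forall x : 'rV[R]_m, `|x *m B| <= C * `|x|.
Proof.
exists (\sum_i \sum_j `|B i j|); first by do 2 apply: sumr_ge0 => ? _.
move=> x; apply: rV_norm_le => [|j].
  by apply: mulr_ge0 => //; do 2 apply: sumr_ge0 => ? _.
rewrite mxE (le_trans (ler_norm_sum _ _ _))// mulr_suml; apply: ler_sum => i _.
rewrite normrM mulrC ler_pM ?rV_norm_entry//.
by rewrite (bigD1 j)//= lerDl sumr_ge0.
Qed.

Definition pdiff p F v : R := \sum_j pev p (mderiv j F) * v 0 j.

Lemma pdiffD p F G v : pdiff p (F + G) v = pdiff p F v + pdiff p G v.
Proof.
by rewrite /pdiff -big_split; apply: eq_bigr => j _; rewrite mderivD pevD mulrDl.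
Qed.

Lemma pdiffM p F G v :
  pdiff p (F * G) v = pdiff p F v * pev p G + pev p F * pdiff p G v.
Proof.
rewrite /pdiff mulr_suml mulr_sumr -big_split; apply: eq_bigr => j _ /=.
by rewrite mderivM !pevE; ring.
Qed.

(** Induction on the ring operations. The bounds on the value and on the differential are carried
    along because the estimate for a product consumes them. *)
Lemma pev_strict_diff p F : exists2 C, 0 <= C & forall d x y, d <= 1 ->
  `|x - p| <= d -> `|y - p| <= d ->
  [/\ `|pev x F| <= C, `|pdiff p F (x - y)| <= C * `|x - y| &
      `|pev x F - pev y F - pdiff p F (x - y)| <= C * d * `|x - y|].
Proof.
elim/(@mpoly_ring_ind R n): F => [c|i|F G [C C0 FC] [D D0 GD]|F G [C C0 FC] [D D0 GD]].
- exists `|c| => // d x y d1 xp yp; rewrite /pdiff !pevC subrr big1.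
    rewrite subr0 normr0; split=> //; apply: mulr_ge0 => //; apply: mulr_ge0 => //.
    exact: le_trans xp.
  by move=> j _; rewrite mderivC pev0 mul0r.
- exists (`|p| + 1) => [|d x y d1 xp yp]; first by rewrite addr_ge0.
  have -> : pdiff p 'X_i (x - y) = (x - y) 0 i.
    rewrite /pdiff (bigD1 i)//= mderivXU eqxx pev1 mul1r big1 ?addr0// => j ji.
    by rewrite mderivXU eq_sym (negPf ji) pev0 mul0r.
  rewrite !pevX !mxE subrr normr0; split.
  + rewrite (le_trans (rV_norm_entry _ _))// -[x](subrK p) (le_trans (ler_normD _ _))//.
    by rewrite addrC lerD2l (le_trans xp).
  + have := rV_norm_entry (x - y) i; rewrite !mxE => /le_trans; apply.
    by rewrite ler_peMl// lerDr.
  + by rewrite !mulr_ge0// ?addr_ge0//; exact: le_trans xp.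
- exists (C + D) => [|d x y d1 xp yp]; first by rewrite addr_ge0.
  have [F1 F2 F3] := FC d x y d1 xp yp; have [G1 G2 G3] := GD d x y d1 xp yp.
  rewrite !pevD pdiffD; split.
  + exact: le_trans (ler_normD _ _) (lerD F1 G1).
  + by rewrite mulrDl; exact: le_trans (ler_normD _ _) (lerD F2 G2).
  + rewrite (_ : _ - _ = (pev x F - pev y F - pdiff p F (x - y)) +
       (pev x G - pev y G - pdiff p G (x - y))); last by ring.
    by rewrite !mulrDl; exact: le_trans (ler_normD _ _) (lerD F3 G3).
(* 6 = 1 + 1 + 2 + 2, one summand for each of the four terms into which the remainder of a product
   is split below. *)
- exists (6 * C * D) => [|d x y d1 xp yp]; first by rewrite !mulr_ge0.
  have d0 : 0 <= d by exact: le_trans xp.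
  have [F1 F2 F3] := FC d x y d1 xp yp; have [G1 G2 G3] := GD d x y d1 xp yp.
  have pp : `|p - p| <= d by rewrite subrr normr0.
  have [Fp _ _] := FC d p p d1 pp pp; have [Gp _ _] := GD d p p d1 pp pp.
  have [Fy _ _] := FC d y p d1 yp pp.
  have near_p E H (H0 : 0 <= H) (EH : forall d x y, d <= 1 -> `|x - p| <= d ->
      `|y - p| <= d -> [/\ `|pev x E| <= H, `|pdiff p E (x - y)| <= H * `|x - y| &
      `|pev x E - pev y E - pdiff p E (x - y)| <= H * d * `|x - y|]) z :
      `|z - p| <= d -> `|pev z E - pev p E| <= 2 * H * d.
    move=> zp; have [_ E2 E3] := EH d z p d1 zp pp.
    rewrite -(subrK (pdiff p E (z - p)) (pev z E - pev p E)).
    rewrite (le_trans (ler_normD _ _))// (_ : 2 * H * d = H * d + H * d); last by ring.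
    apply: lerD; last by rewrite (le_trans E2)// ler_wpM2l.
    rewrite (le_trans E3)// -mulrA ler_wpM2l// -[leRHS]mulr1 ler_wpM2l//.
    exact: le_trans zp d1.
  have Gx := near_p G D D0 GD x xp; have Fy' := near_p F C C0 FC y yp.
  set h := `|x - y|; have h0 : 0 <= h := normr_ge0 _.
  rewrite !pevM pdiffM; split.
  + rewrite normrM (le_trans (ler_pM _ _ F1 G1))// -[leLHS]mul1r -mulrA.
    by rewrite ler_wpM2r ?mulr_ge0// ler1n.
  + rewrite (le_trans (ler_normD _ _))// !normrM.
    rewrite (@le_trans _ _ ((C * h) * D + C * (D * h)))//.
      by apply: lerD; apply: ler_pM.
    rewrite (_ : _ + _ = 2 * (C * D * h)); last by ring.
    rewrite -!mulrA ler_wpM2r ?ler_nat// !mulr_ge0//.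
  + rewrite (_ : _ - _ = (pev x F - pev y F - pdiff p F (x - y)) * pev x G +
        pev y F * (pev x G - pev y G - pdiff p G (x - y)) +
        pdiff p F (x - y) * (pev x G - pev p G) +
        (pev y F - pev p F) * pdiff p G (x - y)); last by ring.
    rewrite (_ : 6 * C * D * d * h = (C * d * h) * D + C * (D * d * h) +
        (C * h) * (2 * D * d) + (2 * C * d) * (D * h)); last by ring.
    do 3 (rewrite (le_trans (ler_normD _ _))//; apply: lerD; rewrite ?normrM; last by apply: ler_pM).
    by apply: ler_pM.
Qed.

Lemma pev_near p F e : 0 < e ->
  exists2 d, 0 < d & forall x, `|x - p| < d -> `|pev x F - pev p F| < e.
Proof.
move=> e0; have [C C0 FC] := pev_strict_diff p F.
exists (Num.min 1 (e / (2 * C + 1))) => [|x].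
  by rewrite lt_min ltr01 divr_gt0//; lra.
rewrite lt_min => /andP[x1 xe].
have [] := FC `|x - p| x p (ltW x1) (lexx _) _; first by rewrite subrr normr0.
set h := `|x - p| in x1 xe *; have h0 : 0 <= h := normr_ge0 _.
move=> _ F2 F3; rewrite -(subrK (pdiff p F (x - p)) (pev x F - pev p F)).
rewrite (le_lt_trans (ler_normD _ _))// (le_lt_trans (lerD F3 F2))//.
move: xe; rewrite ltr_pdivlMr; last by lra.
move=> he; apply: le_lt_trans he.
have : C * h * h <= C * h * 1 by rewrite ler_wpM2l ?mulr_ge0// ltW.
lra.
Qed.

Lemma nbhs_distP (K : numFieldType) (V : normedModType K) (p : V) (A : set V) :
  nbhs p A <-> exists2 d : K, 0 < d & forall x : V, `|x - p| < d -> A x.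
Proof.
split=> [/nbhs_ballP[d d0 dA]|[d d0 dA]].
  by exists d => // x xd; apply: dA; rewrite -ball_normE /= distrC.
by apply/nbhs_ballP; exists d => //= x; rewrite -ball_normE /= distrC; apply: dA.
Qed.

Lemma pev_continuous F : continuous (fun x => pev x F).
Proof.
move=> p B /nbhs_distP[e e0 eB]; have [d d0 dF] := pev_near p F e0.
by apply/nbhs_distP; exists d => // x /dF /eB.
Qed.
End polynomial_calculus.

HB.instance Definition _ (R : realType) n := Complete.copy 'rV[R]_n 'rV[R]_n.

(** * A quantitative inverse function theorem for polynomial maps *)

Section inverse_function.
Variables (R : realType) (n : nat) (Phi : 'I_n -> mpoly n R) (p : 'rV[R]_n).
Implicit Types x y w : 'rV[R]_n.

Definition polymap x : 'rV[R]_n := \row_i pev x (Phi i).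

Let A : 'M[R]_n := \matrix_(i, j) pev p (mderiv j (Phi i)).

Lemma polymap_strict_diff : exists2 C, 0 <= C & forall d x y, d <= 1 ->
  `|x - p| <= d -> `|y - p| <= d ->
  `|polymap x - polymap y - (x - y) *m A^T| <= C * d * `|x - y|.
Proof.
have /choice[C CP] : forall i, exists C, 0 <= C /\ forall d x y, d <= 1 ->
    `|x - p| <= d -> `|y - p| <= d ->
    `|pev x (Phi i) - pev y (Phi i) - pdiff p (Phi i) (x - y)| <= C * d * `|x - y|.
  move=> i; have [C C0 CP] := pev_strict_diff p (Phi i).
  by exists C; split=> // d x y d1 xp yp; have [] := CP d x y d1 xp yp.
have C0 i : 0 <= C i by have [] := CP i.
exists (\sum_i C i) => [|d x y d1 xp yp]; first by apply: sumr_ge0.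
have d0 : 0 <= d by exact: le_trans xp.
apply: rV_norm_le => [|i]; first by rewrite !mulr_ge0// sumr_ge0.
rewrite !mxE (_ : \sum_j _ = pdiff p (Phi i) (x - y)); last first.
  by apply: eq_bigr => j _; rewrite !mxE mulrC.
have [_ CPi] := CP i; rewrite (le_trans (CPi d x y d1 xp yp))//.
rewrite -!mulrA ler_wpM2r ?mulr_ge0// (bigD1 i)//= lerDl sumr_ge0//.
Qed.

(* The contraction principle for the simplified Newton map
   [x |-> x - (Phi x - w) A^-1]. *)
Lemma polymap_inverse : A \in unitmx -> exists d0 K, [/\ 0 < d0, 0 < K,
  forall x y, `|x - p| <= d0 -> `|y - p| <= d0 -> `|x - y| <= K * `|polymap x - polymap y| &
  forall d w, 0 < d -> d <= d0 -> K * `|w - polymap p| <= d ->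
    exists2 x, `|x - p| <= d & polymap x = w].
Proof.
move=> Au; have ATu : A^T \in unitmx by rewrite unitmx_tr.
have [C C0 CP] := polymap_strict_diff.
pose B := invmx A^T; have [K' K'0 KP'] := rV_mulmx_bound B.
pose K := K' + 1; have K0 : 0 < K by rewrite /K ltr_wpDl.
have KP (v : 'rV_n) : `|v *m B| <= K * `|v|.
  by rewrite (le_trans (KP' _))// ler_wpM2r// /K lerDl.
(* This radius makes [K * C * d0] at most 1/2, so the Newton map halves distances. *)
pose d0 := Num.min 1 (2 * (K * C + 1))^-1.
have KC0 : 0 <= K * C by rewrite mulr_ge0// ltW.
have d00 : 0 < d0 by rewrite lt_min ltr01 invr_gt0; lra.
have d01 : d0 <= 1 by rewrite /d0 ge_min lexx.
have dKC : K * (C * d0) <= 2^-1.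
  rewrite mulrA; have : d0 <= (2 * (K * C + 1))^-1 by rewrite /d0 ge_min lexx orbT.
  rewrite -[leRHS]mul1r ler_pdivlMr; lra.
pose g w x := x - (polymap x - w) *m B.
have gB w x y : g w x - g w y = - ((polymap x - polymap y - (x - y) *m A^T) *m B).
  rewrite /g !mulmxBl -!mulmxA mulmxV// !mulmx1.
  move: (polymap x *m B) (polymap y *m B) (w *m B) => a b c.
  by apply/rowP => j; rewrite !mxE; ring.
have gctr w x y : `|x - p| <= d0 -> `|y - p| <= d0 ->
    `|g w x - g w y| <= 2^-1 * `|x - y|.
  move=> xp yp; rewrite gB normrN (le_trans (KP _))//.
  rewrite (le_trans (ler_wpM2l (ltW K0) (CP d0 x y d01 xp yp)))//.
  by rewrite mulrA ler_wpM2r.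
exists d0, (2 * K); split=> //; first by rewrite mulr_gt0.
  move=> x y xp yp; have := gctr 0 x y xp yp.
  have -> : g 0 x - g 0 y = (x - y) - (polymap x - polymap y) *m B.
    rewrite /g !subr0 mulmxBl; move: (polymap x *m B) (polymap y *m B) => a b.
    by apply/rowP => j; rewrite !mxE; ring.
  set u := x - y; set v := _ *m B => uv; have := KP (polymap x - polymap y); rewrite -/v => vK.
  have : `|u| <= `|u - v| + `|v| by rewrite -{1}(subrK v u) ler_normD.
  lra.
move=> d w dp dd0 wd.
pose U := [set x : 'rV[R]_n | `|x - p| <= d].
have gU : set_fun U U (g w).
  move=> x; rewrite /U /= => xd.
  have pd0 : `|p - p| <= d0 by rewrite subrr normr0 ltW.
  have h1 := gctr w x p (le_trans xd dd0) pd0.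
  have h2 : `|g w p - p| <= K * `|w - polymap p|.
    by rewrite /g addrAC subrr add0r normrN distrC (le_trans (KP _)).
  have : `|g w x - p| <= `|g w x - g w p| + `|g w p - p|.
    by rewrite -{1}(subrK (g w p) (g w x)) -addrA ler_normD.
  lra.
pose f : {fun U >-> U} := HB.pack (g w) (isFun.Build _ _ U U (g w) gU).
have ctr : is_contraction f.
  exists (2^-1)%:nng; split=> /=; first by lra.
  move=> [x y] [/= Ux Uy]; apply: gctr; [exact: le_trans dd0|exact: le_trans dd0].
have clU : closed U.
  have -> : U = closed_ball_ Num.norm p d.
    by apply/seteqP; split=> x; rewrite /U /closed_ball_ /= distrC.
  exact: closed_closed_ball_.
have [|x Ux xE] := banach_fixed_point ctr clU; first by exists p; rewrite /U /= subrr normr0 ltW.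
exists x => //; have : (polymap x - w) *m B = 0.
  have : x = g w x by exact: xE.
  by rewrite /g => /esym/eqP; rewrite subr_eq addrC -subr_eq subrr eq_sym => /eqP.
move/(congr1 (mulmx^~ A^T)); rewrite -mulmxA mulVmx// mulmx1 mul0mx => /eqP.
by rewrite subr_eq0 => /eqP.
Qed.
End inverse_function.

(** * One-variable calculus and linear differential systems *)

Section real_lemmas.
Variable R : realType.

Lemma is_derive_small_o (f : R -> R) (x l : R) :
  (forall e, 0 < e -> exists2 d, 0 < d &
     forall h, `|h| < d -> `|f (x + h) - f x - l * h| <= e * `|h|) ->
  is_derive x 1 f l.
Proof.
move=> fl.
have fcvg : (fun h : R => h^-1 *: ((f \o shift x) (h *: (1 : R)) - f x)) @ 0^' --> l.
  apply/cvgrPdist_le => e e0; have [d d0 dP] := fl e e0.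
  near=> h.
  have h0 : h != 0 by near: h; exact: nbhs_dnbhs_neq.
  have hd : `|h| < d.
    near: h; apply: nbhs_dnbhs; apply/nbhs_distP; exists d => // z.
    by rewrite subr0.
  have hgt : 0 < `|h| by rewrite normr_gt0.
  rewrite -(ler_pM2r hgt).
  suff -> : `|l - h^-1 *: ((f \o shift x) (h *: (1 : R)) - f x)| * `|h| = `|f (x + h) - f x - l * h|.
    exact: dP.
  rewrite -normrM distrC mulrBl [x + h]addrC; congr (`| _ |).
  by rewrite /GRing.scale /= mulr1; field.
apply: DeriveDef; first by apply/cvg_ex; exists l.
exact: cvg_lim fcvg.
Unshelve. all: by end_near. Qed.

Lemma is_derive_continuous (f : R -> R) (x l : R) :
  is_derive x 1 f l -> {for x, continuous f}.
Proof.
by move=> fx; apply/differentiable_continuous/derivable1_diffP; exact: ex_derive.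
Qed.

Lemma is_derive_within_continuous (f df : R -> R) (a b : R) :
  (forall x, x \in `[a, b]%R -> is_derive x 1 f (df x)) -> {within `[a, b], continuous f}.
Proof.
move=> fdf; apply: derivable_within_continuous => x xab.
by have := fdf x xab => ?; exact: ex_derive.
Qed.

(** Grönwall's argument: the energy [e], the sum of the squares of the [u i], satisfies
    [e' <= K * e], so its product with [expR (- K * t)] does not increase from its initial value
    0. *)
Lemma linear_system_zero (N : nat) (u : 'I_N -> R -> R) (a : 'I_N -> 'I_N -> R -> R) (C : R) :
  (forall i (t : R), t \in `[0, 1]%R -> is_derive t 1 (u i) (\sum_j a i j t * u j t)) ->
  (forall i j (t : R), t \in `[0, 1]%R -> `|a i j t| <= C) ->
  (forall i, u i 0 = 0) -> forall i, u i 1 = 0.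
Proof.
move=> du aC u0.
pose K : R := 2 * N%:R * C.
pose e : R -> R := \sum_(i < N) u i ^+ 2.
pose de t := \sum_(i < N) (2 * u i t ^+ 1) *: (\sum_j a i j t * u j t).
have eE t : e t = \sum_(i < N) u i t ^+ 2.
  by rewrite /e fct_sumE; apply: eq_bigr => i _; rewrite exprfctE.
have dE (t : R) : t \in `[0, 1]%R -> is_derive t 1 e (de t).
  by move=> t01; apply: is_derive_sum => i; have := du i t t01 => ?; exact: is_deriveX.
pose x : R -> R := expR \o (fun t => - K * t).
have dx (t : R) : is_derive t 1 x (expR (- K * t) * - K).
  apply: is_derive1_comp; apply: is_derive_small_o => eps eps0; exists 1 => // h _.
  rewrite (_ : _ - _ - _ = 0); last by ring.
  by rewrite normr0 mulr_ge0// ltW.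
pose w : R -> R := e * x.
have dw (t : R) : t \in `[0, 1]%R -> is_derive t 1 w ((de t - K * e t) * x t).
  move=> t01; have := dE t t01 => ?; have := dx t => ?.
  by apply: is_derive_eq; rewrite /GRing.scale /= /x /=; ring.
have dw0 (t : R) : t \in `[0, 1]%R -> (de t - K * e t) * x t <= 0.
  move=> t01; apply: mulr_le0_ge0; last exact: expR_ge0.
  rewrite subr_le0.
  have -> : K * e t = \sum_(i < N) \sum_(j < N) C * (u i t ^+ 2 + u j t ^+ 2).
    under eq_bigr do rewrite -mulr_sumr big_split /= sumr_const card_ord -eE -mulr_natl.
    by rewrite -mulr_sumr big_split /= sumr_const card_ord -mulr_natl -mulr_sumr -eE /K; ring.
  rewrite /de ler_sum// => i _; rewrite expr1 /GRing.scale /= mulr_sumr ler_sum// => j _.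
  have aij := aC i j t t01; have C0 : 0 <= C by exact: le_trans aij.
  apply: le_trans (ler_norm _) _; rewrite !normrM ger0_norm//.
  apply: (@le_trans _ _ (C * (2 * `|u i t| * `|u j t|))).
    rewrite (_ : _ * (`|a i j t| * _) = `|a i j t| * (2 * `|u i t| * `|u j t|)); last by ring.
    by rewrite ler_wpM2r// !mulr_ge0.
  rewrite ler_wpM2l// -(real_normK (num_real (u i t))) -(real_normK (num_real (u j t))).
  move: `|u i t| `|u j t| => y z.
  by rewrite -subr_ge0 (_ : _ - _ = (y - z) ^+ 2) ?sqr_ge0//; ring.
pose dwt t := (de t - K * e t) * x t.
have hd (t : R) : t \in `]0, 1[%R -> is_derive t 1 w (dwt t).
  by move=> t01; apply: dw; apply: subset_itv_oo_cc t01.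
have hc : {within `[0, 1], continuous w} by exact: (is_derive_within_continuous dw).
have [c c01 wE] := MVT_segment ler01 hd hc.
have dwc : dwt c <= 0 by exact: dw0.
have wM t : w t = e t * x t by [].
have w1 : w 1 <= 0.
  have w0 : w 0 = 0.
    by rewrite wM eE big1 ?mul0r// => i _; rewrite u0 expr0n.
  by move: wE; rewrite w0 subr0 subr0 mulr1 => ->.
have e1 : e 1 <= 0.
  by move: w1; rewrite wM pmulr_lle0// /x /= expR_gt0.
move=> i; apply/eqP; rewrite -sqrf_eq0; apply/eqP.
have e10 : \sum_(i < N) u i 1 ^+ 2 = 0.
  by apply/eqP; rewrite eq_le -{1}eE e1 sumr_ge0// => j _; exact: sqr_ge0.
by have /psumr_eq0P -> := e10 => // j _; exact: sqr_ge0.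
Qed.
End real_lemmas.

(** * Charts *)

(** Cofactors of a row do not see that row; hence a determinant with one varying row is linear in
    it, with fixed coefficients. *)
Lemma det_cofactor_row (A : comNzRingType) n (M N : 'M[A]_n) i :
  (forall k j, k != i -> M k j = N k j) -> \det M = \sum_j M i j * cofactor N i j.
Proof.
move=> MN; rewrite (expand_det_row M i); apply: eq_bigr => j _.
congr (_ * _); rewrite /cofactor; congr (_ * \det _).
by apply/matrixP => k l; rewrite !mxE MN// eq_sym neq_lift.
Qed.

(** Meant as local coordinates of the ambient space: the [P i] are equations of the surface, and the
    slots [i0], [i1] hold two coordinates along it. *)
Definition frame (R : realType) n (i0 i1 : 'I_n) (P : 'I_n -> mpoly n R)
    (u g : mpoly n R) (i : 'I_n) : mpoly n R :=
  if i == i0 then u else if i == i1 then g else P i.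

(* On the surface cut out by the [P i], [i != i0, i1], the bracket [jac u g] is
   up to a nowhere zero factor the Jacobian determinant of the pair [(u, g)].
   It is sealed: unfolding determinants makes unification diverge. *)
HB.lock Definition jac (R : realType) n (i0 i1 : 'I_n) (P : 'I_n -> mpoly n R)
    (u g : mpoly n R) : mpoly n R :=
  \det (\matrix_(i, j) mderiv j (frame i0 i1 P u g i)).

Section charts.
Variables (R : realType) (n : nat) (X : set 'rV[R]_n).
Variables (i0 i1 : 'I_n) (P : 'I_n -> mpoly n R).
Hypothesis i01 : i0 != i1.
Hypothesis PX : forall i, i != i0 -> i != i1 -> vanishing_ideal X (P i).
Implicit Types (F G u g : mpoly n R) (x y p : 'rV[R]_n) (a b e d : R).

Local Notation frame := (frame i0 i1 P).
Local Notation jac := (jac i0 i1 P).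

Lemma jacE u g : jac u g = \det (\matrix_(i, j) mderiv j (frame u g i)).
Proof. by rewrite jac.unlock. Qed.

Lemma frame0 u g : frame u g i0 = u.
Proof. by rewrite /frame eqxx. Qed.

Lemma frame1 u g : frame u g i1 = g.
Proof. by rewrite /frame eq_sym (negPf i01) eqxx. Qed.

Lemma frame2 u g i : i != i0 -> i != i1 -> frame u g i = P i.
Proof. by rewrite /frame => /negPf -> /negPf ->. Qed.

Lemma frameE0 u u' g i : i != i0 -> frame u g i = frame u' g i.
Proof. by rewrite /frame => /negPf ->. Qed.

Lemma frameE1 u g g' i : i != i1 -> frame u g i = frame u g' i.
Proof. by rewrite /frame => /negPf ->. Qed.

(** Laplace expansion along the row of [F]: the bracket is a derivation in its first argument. *)
Lemma jac_vfieldl g : exists E, forall F, jac F g = vfield E F.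
Proof.
exists (fun j => cofactor (\matrix_(i, j) mderiv j (frame 0 g i)) i0 j) => F.
rewrite jacE (@det_cofactor_row _ _ _ (\matrix_(i, j) mderiv j (frame 0 g i)) i0).
  by apply: eq_bigr => j _; rewrite mxE frame0 mulrC.
by move=> k j k0; rewrite !mxE (frameE0 _ 0).
Qed.

Lemma jac_vfieldr u : exists E, forall F, jac u F = vfield E F.
Proof.
exists (fun j => cofactor (\matrix_(i, j) mderiv j (frame u 0 i)) i1 j) => F.
rewrite jacE (@det_cofactor_row _ _ _ (\matrix_(i, j) mderiv j (frame u 0 i)) i1).
  by apply: eq_bigr => j _; rewrite mxE frame1 mulrC.
by move=> k j k1; rewrite !mxE (frameE1 _ _ 0).
Qed.

Lemma jacC u g : jac g u = - jac u g.
Proof.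
rewrite !jacE; set M := \matrix_(_, _) _; set N := \matrix_(_, _) _.
have -> : M = row_perm (tperm i0 i1) N.
  apply/matrixP => i j; rewrite !mxE.
  case: tpermP => [->|->|/eqP ni0 /eqP ni1]; rewrite ?frame0 ?frame1//.
  by rewrite !frame2.
by rewrite row_permE det_mulmx det_perm odd_tperm i01 expr1 mulN1r.
Qed.

Let jmx x u g : 'M[R]_n := \matrix_(i, j) pev x (mderiv j (frame u g i)).

Lemma pev_jac x u g : pev x (jac u g) = \det (jmx x u g).
Proof.
rewrite jacE /pev -det_map_mx; congr (\det _).
by apply/matrixP => i j; rewrite !mxE.
Qed.

(** Cramer's rule in the basis formed by the gradients of the frame. The two named coefficients are
    the partial derivatives of [F] along the surface in the coordinates [(u, g)]. *)
Lemma gradient_frame x u g F : pev x (jac u g) != 0 ->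
  exists l : 'I_n -> R, [/\
    forall j, pev x (mderiv j F) = \sum_i l i * pev x (mderiv j (frame u g i)),
    l i0 = pev x (jac F g) / pev x (jac u g) &
    l i1 = pev x (jac u F) / pev x (jac u g)].
Proof.
rewrite !pev_jac => J0; set A := jmx x u g in J0 *.
have Au : A \in unitmx by rewrite unitmxE unitfE.
pose v : 'rV[R]_n := \row_j pev x (mderiv j F).
pose l : 'rV[R]_n := v *m invmx A.
have lA : l *m A = v by rewrite /l -mulmxA mulVmx// mulmx1.
have key k (N : 'M[R]_n) : (forall i j, i != k -> N i j = A i j) ->
    (forall j, N k j = v 0 j) -> l 0 k = \det N / \det A.
  move=> NA Nk; apply: (mulIf J0); rewrite divfK// (det_cofactor_row NA).
  have -> : \sum_j N k j * cofactor A k j = (v *m \adj A) 0 k.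
    by rewrite mxE; apply: eq_bigr => j _; rewrite Nk !mxE.
  by rewrite -lA -mulmxA mul_mx_adj mul_mx_scalar [RHS]mxE mulrC.
exists (fun i => l 0 i); split.
- move=> j; have := congr1 (fun w : 'rV_n => w 0 j) lA; rewrite !mxE => <-.
  by apply: eq_bigr => i _; rewrite !mxE.
- apply: key => [i j ii0|j]; rewrite !mxE; first by rewrite (frameE0 _ u).
  by rewrite frame0.
- apply: key => [i j ii1|j]; rewrite !mxE; first by rewrite (frameE1 _ _ g).
  by rewrite frame1.
Qed.

(** The inclusion complementary to [PX]: near [p] the equations have no zeros outside [X]. *)
Definition loc_eq p := exists2 d, 0 < d & forall x, `|x - p| < d ->
  (forall i, i != i0 -> i != i1 -> pev x (P i) = 0) -> X x.

Definition box p u g e a b := `|a - pev p u| < e /\ `|b - pev p g| < e.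

(** [th] parametrizes a piece of [X] by the values of [(u, g)]. The field [chart_near] makes its
    image open in [X] and [th] inverse to [(u, g)] there. *)
Record chart p u g e (th : R -> R -> 'rV[R]_n) (K : R) : Prop := Chart {
  chart_gt0 : 0 < e;
  chart_K : 0 < K;
  chart_center : th (pev p u) (pev p g) = p;
  chart_in : forall a b, box p u g e a b -> X (th a b);
  chart_u : forall a b, box p u g e a b -> pev (th a b) u = a;
  chart_g : forall a b, box p u g e a b -> pev (th a b) g = b;
  chart_jac : forall a b, box p u g e a b -> pev (th a b) (jac u g) != 0;
  chart_lip : forall a b a' b', box p u g e a b -> box p u g e a' b' ->
    `|th a b - th a' b'| <= K * (`|a - a'| + `|b - b'|);
  chart_near : forall a b, box p u g e a b -> exists2 d, 0 < d &
    forall x, X x -> `|x - th a b| < d ->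
      box p u g e (pev x u) (pev x g) /\ th (pev x u) (pev x g) = x }.

(** The inverse function theorem for the frame; solutions whose other frame values are 0 lie on [X]
    by [loc_eq]. *)
Lemma chart_exists p u g d1 : X p -> loc_eq p -> pev p (jac u g) != 0 -> 0 < d1 ->
  exists e th K, chart p u g e th K /\
    forall a b, box p u g e a b -> `|th a b - p| < d1.
Proof.
move=> Xp [d3 d30 loc] J0 d10.
have Au : \matrix_(i, j) pev p (mderiv j (frame u g i)) \in unitmx.
  by rewrite unitmxE unitfE -pev_jac.
have [d0 [K [d00 K0 inj surj]]] := polymap_inverse Au.
have [d2 d20 Jnear] := pev_near p (jac u g) (etrans (normr_gt0 _) J0).
(* Half the least of four radii: inverse function theorem, prescribed size, validity range of the
   Jacobian, validity range of the equations. *)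
pose d := Num.min (Num.min d0 d1) (Num.min d2 d3) / 2.
have [dp dd0 dd1 [dd2 dd3]] : [/\ 0 < d, d < d0, d < d1 & d < d2 /\ d < d3].
  have := erefl d; rewrite {2}/d; set m := Num.min _ _.
  have mp : 0 < m by rewrite !lt_min d00 d10 d20.
  have : m <= m by [].
  by rewrite {2}/m !le_min => /andP[/andP[? ?] /andP[? ?]] ?; split; lra.
pose w a b : 'rV[R]_n := \row_i (if i == i0 then a else if i == i1 then b else 0).
have polymapX x : X x -> polymap (frame u g) x = w (pev x u) (pev x g).
  move=> Xx; apply/rowP => i; rewrite !mxE /frame; case: eqVneq => // ii0.
  by case: eqVneq => // ii1; apply: (PX ii0 ii1).
have wB a b a' b' : `|w a b - w a' b'| <= `|a - a'| + `|b - b'|.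
  apply: rV_norm_le => [|i]; first by rewrite addr_ge0.
  rewrite !mxE; case: eqP => _; first by rewrite lerDl.
  by case: eqP => _; rewrite ?lerDr// subrr normr0 addr_ge0.
(* Targets in the box are then within [e + e = d / K] of the central one, as [surj] requires. *)
pose e := d / K / 2; have e0 : 0 < e by rewrite /e divr_gt0// divr_gt0.
have /choice[th thP] : forall ab : R * R, exists x, box p u g e ab.1 ab.2 ->
    `|x - p| <= d /\ polymap (frame u g) x = w ab.1 ab.2.
  move=> [a b] /=; have [[ba bb]|nb] := pselect (box p u g e a b); last by exists p.
  have [|x xd xw] := surj d (w a b) dp (ltW dd0).
    rewrite (polymapX _ Xp) mulrC -ler_pdivlMr//.
    by rewrite (le_trans (wB _ _ _ _))// (_ : d / K = e + e) ?lerD// ?ltW// /e; field; lra.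
  by exists x.
exists e, (fun a b => th (a, b)), K.
have thd a b : box p u g e a b -> `|th (a, b) - p| <= d.
  by move=> ab; have [] := thP (a, b) ab.
have thw a b : box p u g e a b -> polymap (frame u g) (th (a, b)) = w a b.
  by move=> ab; have [] := thP (a, b) ab.
have thi a b i : box p u g e a b -> pev (th (a, b)) (frame u g i) = w a b 0 i.
  by move=> /thw <-; rewrite mxE.
have thX a b : box p u g e a b -> X (th (a, b)).
  move=> ab; apply: loc => [|i ii0 ii1]; first exact: le_lt_trans (thd _ _ ab) dd3.
  by have := thi a b i ab; rewrite frame2// mxE (negPf ii0) (negPf ii1).
have inv x : X x -> `|x - p| <= d0 -> box p u g e (pev x u) (pev x g) ->
    th (pev x u, pev x g) = x.
  move=> Xx xd bx; apply/eqP; rewrite -subr_eq0 -normr_le0.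
  rewrite (le_trans (inj _ _ _ _))//; first exact: le_trans (thd _ _ bx) (ltW dd0).
  by rewrite thw// -polymapX// subrr normr0 mulr0.
split; last by move=> a b ab; exact: le_lt_trans (thd _ _ ab) dd1.
split=> //.
- by apply: inv => //; rewrite ?/box !subrr normr0// ltW.
- by move=> a b ab; rewrite -[X in pev _ X](frame0 u g) thi// mxE eqxx.
- by move=> a b ab; rewrite -[X in pev _ X](frame1 u g) thi// mxE eq_sym (negPf i01) eqxx.
- move=> a b ab; have := Jnear _ (le_lt_trans (thd _ _ ab) dd2).
  by apply: contraTneq => ->; rewrite sub0r normrN ltxx.
- move=> a b a' b' ab ab'; rewrite (le_trans (inj _ _ _ _))//.
  + exact: le_trans (thd _ _ ab) (ltW dd0).
  + exact: le_trans (thd _ _ ab') (ltW dd0).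
  + by rewrite ler_pM2l// !thw.
- move=> a b [ab1 ab2].
  have ua : pev (th (a, b)) u = a by rewrite -[X in pev _ X](frame0 u g) thi// mxE eqxx.
  have gb : pev (th (a, b)) g = b.
    by rewrite -[X in pev _ X](frame1 u g) thi// mxE eq_sym (negPf i01) eqxx.
  have [du du0 duP] := @pev_near _ _ (th (a, b)) u (e - `|a - pev p u|) (etrans (subr_gt0 _ _) ab1).
  have [dg dg0 dgP] := @pev_near _ _ (th (a, b)) g (e - `|b - pev p g|) (etrans (subr_gt0 _ _) ab2).
  exists (Num.min (d0 - d) (Num.min du dg)); first by rewrite !lt_min subr_gt0 dd0 du0.
  move=> x Xx; rewrite !lt_min => /andP[xd /andP[xu xg]].
  have xbox : box p u g e (pev x u) (pev x g).
    have := duP x xu; have := dgP x xg; rewrite ua gb => h1 h2; split.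
      rewrite -(subrK a (pev x u)) -addrA (le_lt_trans (ler_normD _ _))//; lra.
    rewrite -(subrK b (pev x g)) -addrA (le_lt_trans (ler_normD _ _))//; lra.
  split=> //; apply: inv => //.
  rewrite -(subrK (th (a, b)) x) -addrA (le_trans (ler_normD _ _))//.
  by have := thd a b (conj ab1 ab2); lra.
Qed.
End charts.

Lemma pev_meval (R : realType) n (x : 'rV[R]_n) F : pev x F = meval (x 0) F.
Proof. by []. Qed.

Lemma pev_lincomb (R : realType) n (x : 'rV[R]_n) c d F G :
  pev x (mpolyC n c * F + mpolyC n d * G) = c * pev x F + d * pev x G.
Proof. by rewrite pevD !pevM !pevC. Qed.

(** * Differentiation and transport of zeros inside a chart *)

Section chart_calculus.
Variables (R : realType) (n : nat) (X : set 'rV[R]_n).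
Variables (i0 i1 : 'I_n) (P : 'I_n -> mpoly n R).
Hypothesis i01 : i0 != i1.
Hypothesis PX : forall i, i != i0 -> i != i1 -> vanishing_ideal X (P i).
Implicit Types (F G u g : mpoly n R) (x y p : 'rV[R]_n) (a b e d : R).
Local Notation jac := (jac i0 i1 P).

Lemma loc_eq_near p : loc_eq X i0 i1 P p -> exists2 d, 0 < d &
  forall q, `|q - p| < d -> loc_eq X i0 i1 P q.
Proof.
move=> [d d0 dP]; exists (d / 2) => [|q qp]; first by rewrite divr_gt0.
exists (d / 2) => [|x xq]; first by rewrite divr_gt0.
apply: dP; rewrite -(subrK q x) -addrA (le_lt_trans (ler_normD _ _))//; lra.
Qed.

Section one_chart.
Variables (p : 'rV[R]_n) (u g : mpoly n R) (e : R) (th : R -> R -> 'rV[R]_n) (K : R).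
Hypothesis ch : chart X i0 i1 P p u g e th K.
Local Notation box := (box p u g e).

Lemma box_segment a b a' b' t : t \in `[0, 1]%R -> box a b -> box a' b' ->
  box (a + t * (a' - a)) (b + t * (b' - b)).
Proof.
rewrite in_itv /= => /andP[t0 t1] [au bg] [a'u b'g].
have conv (c c' z : R) : `|c - z| < e -> `|c' - z| < e -> `|c + t * (c' - c) - z| < e.
  move=> h h'; rewrite (_ : _ - z = (1 - t) * (c - z) + t * (c' - z)); last by ring.
  rewrite (le_lt_trans (ler_normD _ _))// !normrM (ger0_norm t0) ger0_norm ?subr_ge0//.
  have e0 := chart_gt0 ch.
  have [->|tn0] := eqVneq t 0; first by rewrite subr0 mul1r mul0r addr0.
  have h1 : (1 - t) * `|c - z| <= (1 - t) * e by rewrite ler_wpM2l ?subr_ge0// ltW.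
  have h2 : t * `|c' - z| < t * e by rewrite ltr_pM2l// lt_def tn0.
  lra.
by split; apply: conv.
Qed.

(** Subtracting from [F] its gradient's combination of the frame leaves [H] with zero differential
    at the point, hence a quadratic increment. Along [X] the equations do not vary, and [u], [g]
    vary exactly linearly. *)
Lemma chart_derive F a b al be t : box (a + t * al) (b + t * be) ->
  is_derive t 1 (fun s => pev (th (a + s * al) (b + s * be)) F)
    ((al * pev (th (a + t * al) (b + t * be)) (jac F g) +
      be * pev (th (a + t * al) (b + t * be)) (jac u F)) /
     pev (th (a + t * al) (b + t * be)) (jac u g)).
Proof.
set x := th (a + t * al) (b + t * be) => bt.
have J0 : pev x (jac u g) != 0 by exact: (chart_jac ch).
have [l [lF l0 l1]] := gradient_frame i01 F J0.
have DE : (al * pev x (jac F g) + be * pev x (jac u F)) / pev x (jac u g) = al * l i0 + be * l i1.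
  have distr (a1 a2 b1 b2 c : R) : (a1 * b1 + a2 * b2) / c = a1 * (b1 / c) + a2 * (b2 / c).
    by rewrite mulrDl !mulrA.
  by rewrite l0 l1; exact: distr.
rewrite DE.
have K0 := chart_K ch.
pose H := F - \sum_i mpolyC n (l i) * frame i0 i1 P u g i.
have dH : forall v, pdiff x H v = 0.
  move=> v; rewrite /pdiff big1// => j _; rewrite /H mderivB pevB lF.
  have -> : mderiv j (\sum_i mpolyC n (l i) * frame i0 i1 P u g i) =
      \sum_i mpolyC n (l i) * mderiv j (frame i0 i1 P u g i).
    rewrite raddf_sum; apply: eq_bigr => i _ /=.
    by rewrite mderivM mderivC mul0r add0r.
  rewrite pev_sum.
  by under [X in _ - X]eq_bigr do rewrite pevM pevC; rewrite subrr mul0r.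
have [C C0 CH] := pev_strict_diff x H.
pose L := K * (`|al| + `|be|); have L0 : 0 <= L by rewrite mulr_ge0 ?addr_ge0// ltW.
have [r r0 rP] : exists2 r, 0 < r & forall h, `|h| < r ->
    box (a + (t + h) * al) (b + (t + h) * be).
  have [b1 b2] := bt.
  pose r1 := (e - `|a + t * al - pev p u|) / (`|al| + 1).
  pose r2 := (e - `|b + t * be - pev p g|) / (`|be| + 1).
  have [al0 be0] : 0 < `|al| + 1 /\ 0 < `|be| + 1 by split; rewrite ltr_wpDl.
  exists (Num.min r1 r2); first by rewrite lt_min !divr_gt0 ?subr_gt0.
  have step z c s h : 0 < `|s| + 1 -> `|h| < (e - `|z + t * s - c|) / (`|s| + 1) ->
      `|z + (t + h) * s - c| < e.
    move=> s0; rewrite ltr_pdivlMr// => hs.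
    rewrite (_ : _ - c = (z + t * s - c) + h * s); last by ring.
    rewrite (le_lt_trans (ler_normD _ _))// normrM -ltrBrDl (le_lt_trans _ hs)//.
    by rewrite ler_wpM2l// lerDl.
  by move=> h; rewrite lt_min => /andP[h1 h2]; split; apply: step.
apply: is_derive_small_o => eps eps0.
pose M := C * L * L + 1; have M0 : 0 < M by rewrite /M ltr_wpDl// mulr_ge0// mulr_ge0.
(* The three bounds keep the curve in the box, keep it at distance at most 1, and make the quadratic
   remainder smaller than [eps] times the increment. *)
exists (Num.min r (Num.min (L + 1)^-1 (eps / M))).
  by rewrite !lt_min r0 invr_gt0 divr_gt0// ltr_wpDl.
move=> h; rewrite !lt_min => /andP[hr /andP[hL hM]].
have bh := rP h hr; set y := th (a + (t + h) * al) (b + (t + h) * be).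
have yx : `|y - x| <= L * `|h|.
  rewrite (le_trans (chart_lip ch bh bt))// /L -mulrA ler_pM2l//.
  rewrite (_ : _ - _ = h * al); last by ring.
  rewrite (_ : _ - _ = h * be); last by ring.
  by rewrite !normrM mulrDl ![_ * `|h|]mulrC.
have yx1 : `|y - x| <= 1.
  rewrite (le_trans yx)//; move: hL; rewrite -[ltRHS]mul1r ltr_pdivlMr ?ltr_wpDl// => hL.
  by rewrite mulrC (le_trans _ (ltW hL))// ler_wpM2l// lerDl.
have [_ _] := CH `|y - x| y x yx1 (lexx _) ltac:(by rewrite subrr normr0).
rewrite dH subr0 => Hyx.
have fr i : i != i0 -> i != i1 ->
    pev y (frame i0 i1 P u g i) - pev x (frame i0 i1 P u g i) = 0.
  move=> ii0 ii1; rewrite frame2//.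
  rewrite !pev_meval (PX ii0 ii1 (chart_in ch bh)) (PX ii0 ii1 (chart_in ch bt)).
  by rewrite subrr.
have HE : pev y H - pev x H =
    pev y F - pev x F - (al * l i0 + be * l i1) * h.
  have sub4 (a1 a2 b1 b2 : R) : (a1 - a2) - (b1 - b2) = a1 - b1 - (a2 - b2) by ring.
  rewrite /H !pevB sub4; congr (_ - _); rewrite !pev_sum -sumrB.
  rewrite (bigD1 i0)//= (bigD1 i1) 1?eq_sym//= big1 ?addr0; last first.
    by move=> i /andP[ii0 ii1]; rewrite !pevM !pevC -mulrBr fr ?mulr0.
  rewrite !pevM !pevC !frame0 !(frame1 _ i01) -!mulrBr.
  rewrite (chart_u ch bh) (chart_u ch bt) (chart_g ch bh) (chart_g ch bt).
  by move: (l i0) (l i1) => k0 k1; ring.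
rewrite -HE (le_trans Hyx)//.
apply: (@le_trans _ _ (C * (L * `|h|) * (L * `|h|))).
  by apply: ler_pM => //; [rewrite mulr_ge0|rewrite ler_wpM2l].
rewrite (_ : C * _ * _ = (C * L * L * `|h|) * `|h|); last by ring.
rewrite ler_wpM2r//; move: hM; rewrite ltr_pdivlMr// /M => hM.
by rewrite mulrC (le_trans _ (ltW hM))// ler_wpM2l// lerDl.
Qed.

(* The linear differential system satisfied by generators of [I] along the
   segment forces them to stay zero. *)
Lemma chart_transport (I : set (mpoly n R)) a b a' b' :
  is_ideal I -> box a b -> box a' b' ->
  (forall F, I F -> I (mpolyC n (a' - a) * jac F g + mpolyC n (b' - b) * jac u F)) ->
  (forall F, I F -> pev (th a b) F = 0) -> forall F, I F -> pev (th a' b') F = 0.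
Proof.
move=> iI bab bab' DI F0.
(* Finitely many generators of [I] suffice: their derivatives along the segment are combinations of
   the generators, which closes the system. *)
have [s [sI sgen]] := @noetherian_mpoly R n I iI.
pose D F := mpolyC n (a' - a) * jac F g + mpolyC n (b' - b) * jac u F.
pose f (i : 'I_(size s)) := nth 0 s i.
have fI i : I (f i) by apply: sI; rewrite mem_nth.
pose J := [set F | exists c : 'I_(size s) -> mpoly n R, F = \sum_i c i * f i].
have iJ : is_ideal J.
  split.
  - by exists (fun=> 0); rewrite big1// => i _; rewrite mul0r.
  - move=> _ _ [c ->] [c' ->]; exists (fun i => c i + c' i).
    by rewrite -big_split; apply: eq_bigr => i _; rewrite mulrDl.
  - move=> G _ [c ->]; exists (fun i => G * c i).
    by rewrite mulr_sumr; apply: eq_bigr => i _; rewrite mulrA.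
have IJ F : I F -> J F.
  apply: sgen => // G /(nthP 0)[k ks <-].
  exists (fun i => (i == Ordinal ks)%:R); rewrite (bigD1 (Ordinal ks))//= eqxx mul1r.
  by rewrite big1 ?addr0// => i /negPf ->; rewrite mul0r.
have /choice[c cE] : forall i, exists c : 'I_(size s) -> mpoly n R, D (f i) = \sum_j c j * f j.
  by move=> i; apply: IJ; apply: DI.
pose al := a' - a; pose be := b' - b.
pose ga t := th (a + t * al) (b + t * be).
have bt t : t \in `[0, 1]%R -> box (a + t * al) (b + t * be).
  by move=> t01; apply: box_segment.
pose v i t := pev (ga t) (f i).
pose A i j t := pev (ga t) (c i j) / pev (ga t) (jac u g).
have dv i (t : R) : t \in `[0, 1]%R -> is_derive t 1 (v i) (\sum_j A i j t * v j t).
  move=> t01; apply: is_derive_eq; first exact: chart_derive (bt t t01).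
  rewrite -/(ga t).
  have DE : al * pev (ga t) (jac (f i) g) + be * pev (ga t) (jac u (f i)) = pev (ga t) (D (f i)).
    by apply: esym; exact: pev_lincomb.
  rewrite DE.
  rewrite cE pev_sum mulr_suml; apply: eq_bigr => j _.
  by rewrite /A /v pevM mulrAC.
have cont F (t : R) : t \in `[0, 1]%R -> {for t, continuous (fun t => pev (ga t) F)}.
  by move=> t01; apply: is_derive_continuous; exact: chart_derive (bt t t01).
have /choice[C CP] : forall ij : 'I_(size s) * 'I_(size s), exists C, forall t : R,
    t \in `[0, 1]%R -> `|A ij.1 ij.2 t| <= C.
  move=> [i j] /=; have cA : {within `[0, 1], continuous (fun t => `|A i j t|)}.
    apply: continuous_in_subspaceT => t; rewrite inE => t01.
    apply: (@cvg_comp _ _ _ (A i j) Num.norm); last exact: norm_continuous.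
    apply: cvgM; first exact: cont.
    apply: cvgV; last exact: cont.
    by apply: (chart_jac ch); exact: bt.
  have [m m01 mP] := EVT_max ler01 cA.
  by exists `|A i j m|.
have C0 ij : 0 <= C ij.
  apply: le_trans (CP ij 0 _); first by [].
  by rewrite in_itv /= lexx ler01.
have v0 i : v i 0 = 0 by rewrite /v /ga !mul0r !addr0 F0.
have AC i j (t : R) : t \in `[0, 1]%R -> `|A i j t| <= \sum_i \sum_j C (i, j).
  move=> t01.
  rewrite (le_trans (CP (i, j) t t01))// (bigD1 i)//= (bigD1 j)//= -addrA lerDl.
  by rewrite addr_ge0 ?sumr_ge0// => k _; rewrite sumr_ge0.
have v1 := linear_system_zero dv AC v0.
move=> F /IJ[cF ->]; rewrite pev_sum big1// => i _.
have := v1 i; rewrite /v /ga !mul1r /al /be addrC subrK addrC subrK pevM => ->.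
by rewrite mulr0.
Qed.
End one_chart.
End chart_calculus.

(** * The identity theorem on a chart and Zariski density *)

Lemma is_prime_closed (R : realType) n (I : set (mpoly n R)) :
  is_prime I -> idealr_closed [in I] /\ prime_idealr_closed [in I].
Proof.
move=> [[I0 ID IM] I1 IP]; split.
  split; rewrite ?inE//; first by apply/negP; rewrite inE.
  by move=> a x y; rewrite !inE => Ix Iy; apply: ID => //; apply: IM.
by move=> x y; rewrite inE => /IP[Ix|Iy]; apply/orP; [left|right]; rewrite inE.
Qed.

Lemma vanishing_point_prime (R : realType) n (x : 'rV[R]_n) :
  is_prime (vanishing_ideal [set x]).
Proof.
split; first exact: vanishing_is_ideal.
  by move=> /(_ x erefl)/eqP; rewrite meval1 oner_eq0.
move=> F G /(_ x erefl)/eqP; rewrite mevalM mulf_eq0 => /orP[]/eqP e; [left|right].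
  by move=> _ ->.
by move=> _ ->.
Qed.

Lemma infinite_not_sub_point (R : realType) n (S : set 'rV[R]_n) x :
  infinite_set S -> ~ vanishing_ideal [set x] `<=` vanishing_ideal S.
Proof.
move=> Sinf xS; apply: Sinf; apply: (@sub_finite_set _ _ [set x]); last exact: finite_set1.
move=> s Ss; apply/rowP => j; apply/eqP; rewrite -subr_eq0; apply/eqP.
have /xS/(_ s Ss) : vanishing_ideal [set x] ('X_j - mpolyC n (x 0 j)).
  by move=> _ ->; rewrite mevalB mevalXU mevalC subrr.
by rewrite mevalB mevalXU mevalC.
Qed.

(** What [exists_prime_vanishing] asks of the family of infinite subsets of [S]. *)
Lemma infinite_family (T : Type) (S : set T) (Fam := fun Z => infinite_set Z /\ Z `<=` S) :
  infinite_set S -> [/\ Fam !=set0, ~ Fam set0 &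
  forall Y Z, Fam (Y `|` Z) -> Fam Y \/ Fam Z].
Proof.
move=> Sinf; split; first by exists S; split.
  by move=> [i0 _]; apply: i0; exact: finite_set0.
move=> Y Z [/infinite_setU[iY|iZ] YZS]; [left|right]; split=> // x xY; apply: YZS.
  by left.
by right.
Qed.

Lemma infinite_of_injection (T : Type) (A : set T) (f : nat -> T) :
  injective f -> (forall k, A (f k)) -> infinite_set A.
Proof.
move=> finj fA; have /injfunPex[h] : exists2 f : nat -> T, set_fun setT A f & set_inj setT f.
  by exists f => [k _|k l _ _ /finj]; [exact: fA|].
by apply/infiniteP; exact: inj_card_le h.
Qed.

Section chart_domain.
Variables (R : realType) (n : nat) (X : set 'rV[R]_n).
Variables (i0 i1 : 'I_n) (P : 'I_n -> mpoly n R).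
Hypothesis i01 : i0 != i1.
Hypothesis PX : forall i, i != i0 -> i != i1 -> vanishing_ideal X (P i).
Implicit Types (F G u g : mpoly n R) (x y : 'rV[R]_n) (a b d : R).
Local Notation jac := (jac i0 i1 P).
Variables (p : 'rV[R]_n) (u g : mpoly n R) (e : R) (th : R -> R -> 'rV[R]_n) (K : R).
Hypothesis ch : chart X i0 i1 P p u g e th K.
Local Notation box := (box p u g e).

Lemma chart_small a b d : box a b -> 0 < d -> exists2 h, 0 < h &
  forall a' b', `|a' - a| < h -> `|b' - b| < h -> box a' b' /\ `|th a' b' - th a b| < d.
Proof.
move=> [ba bb] d0; have K0 := chart_K ch.
exists (Num.min (Num.min (e - `|a - pev p u|) (e - `|b - pev p g|)) (d / K / 2)).
  by rewrite !lt_min !subr_gt0 ba bb /= divr_gt0// divr_gt0.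
move=> a' b'; rewrite !lt_min => /andP[/andP[a1 _] a2] /andP[/andP[_ b1] b2].
have bx : box a' b'.
  split.
    rewrite -(subrK a a') -addrA (le_lt_trans (ler_normD _ _))//.
    by rewrite -ltrBrDr.
  rewrite -(subrK b b') -addrA (le_lt_trans (ler_normD _ _))//.
  by rewrite -ltrBrDr.
split=> //; rewrite (le_lt_trans (chart_lip ch bx (conj ba bb)))// mulrC -ltr_pdivlMr//.
by rewrite [ltRHS]splitr ltrD.
Qed.

Lemma chart_center_box : box (pev p u) (pev p g).
Proof. by split; rewrite subrr normr0 (chart_gt0 ch). Qed.

Lemma chart_jac_vanish F a b h : box a b -> 0 < h ->
  (forall a' b', `|a' - a| < h -> `|b' - b| < h -> pev (th a' b') F = 0) ->
  pev (th a b) (jac F g) = 0 /\ pev (th a b) (jac u F) = 0.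
Proof.
move=> bab h0 F0; have J0 := chart_jac ch bab.
have key al be : `|al| <= 1 -> `|be| <= 1 ->
    al * pev (th a b) (jac F g) + be * pev (th a b) (jac u F) = 0.
  move=> al1 be1.
  have bab0 : box (a + 0 * al) (b + 0 * be) by rewrite !mul0r !addr0.
  have := chart_derive i01 PX ch F bab0; rewrite !mul0r !addr0 => d1.
  have d2 : is_derive (0 : R) 1 (fun s => pev (th (a + s * al) (b + s * be)) F) 0.
    apply: is_derive_small_o => eps eps0; exists h => // s sh.
    rewrite add0r !mul0r !addr0 [pev (th a b) F]F0 ?subrr ?normr0//.
    rewrite F0 ?subrr ?normr0 ?mulr_ge0 ?(ltW eps0)//.
      by rewrite addrC addKr normrM (le_lt_trans _ sh)// ler_piMr.
    by rewrite addrC addKr normrM (le_lt_trans _ sh)// ler_piMr.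
  have := etrans (esym (@derive_val _ _ _ _ _ _ _ d1)) (@derive_val _ _ _ _ _ _ _ d2).
  by move=> /eqP; rewrite mulf_eq0 invr_eq0 (negPf J0) orbF => /eqP.
have n1 : `|1 : R| <= 1 by rewrite normr1.
have n0 : `|0 : R| <= 1 by rewrite normr0.
have := key 1 0 n1 n0; have := key 0 1 n0 n1.
by rewrite !mul1r !mul0r add0r addr0 => -> ->.
Qed.

(** The polynomials vanishing on [X] near [th a b] form an ideal stable under both partial
    derivatives, so [chart_transport] carries their zeros over the whole box. *)
Lemma chart_identity F a b d : box a b -> 0 < d ->
  (forall x, X x -> `|x - th a b| < d -> pev x F = 0) ->
  forall a' b', box a' b' -> pev (th a' b') F = 0.
Proof.
move=> bab d0 F0 a' b' bab'.
pose I := [set G | exists2 d, 0 < d &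
  forall x, X x -> `|x - th a b| < d -> pev x G = 0].
have iI : is_ideal I.
  split; first by exists 1 => // x _ _; rewrite pev0.
    move=> G H [d1 d10 G0] [d2 d20 H0]; exists (Num.min d1 d2); first by rewrite lt_min d10.
    by move=> x Xx; rewrite lt_min => /andP[x1 x2]; rewrite pevD G0// H0// addr0.
  move=> G H [d1 d10 H0]; exists d1 => // x Xx xd.
  by rewrite pevM H0// mulr0.
have jI G : I G -> I (jac G g) /\ I (jac u G).
  move=> [d1 d10 G0]; have [h h0 hP] := chart_small bab d10.
  (* Half of [h], so that a square around a nearby point stays inside the one given by
     [chart_small]. *)
  have h20 : 0 < h / 2 by rewrite divr_gt0.
  have [r r0 rP] : exists2 r, 0 < r & forall x, X x -> `|x - th a b| < r ->
      pev x (jac G g) = 0 /\ pev x (jac u G) = 0.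
    have [r1 r10 r1P] := chart_near ch bab.
    have [r2 r20 r2P] := pev_near (th a b) u h20.
    have [r3 r30 r3P] := pev_near (th a b) g h20.
    exists (Num.min r1 (Num.min r2 r3)); first by rewrite !lt_min r10 r20.
    move=> x Xx; rewrite !lt_min => /andP[x1 /andP[x2 x3]].
    have [bx thx] := r1P x Xx x1; rewrite -thx.
    have ux := r2P x x2; have gx := r3P x x3.
    rewrite (chart_u ch bab) in ux; rewrite (chart_g ch bab) in gx.
    apply: (chart_jac_vanish (h := h / 2)) => // a1 b1 ha hb.
    have [||b1x thd] := hP a1 b1.
    - rewrite -(subrK (pev x u) a1) -addrA (le_lt_trans (ler_normD _ _))//.
      by rewrite (splitr h) ltrD.
    - rewrite -(subrK (pev x g) b1) -addrA (le_lt_trans (ler_normD _ _))//.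
      by rewrite (splitr h) ltrD.
    by apply: G0 => //; apply: (chart_in ch).
  by split; exists r => // x Xx xr; have [] := rP x Xx xr.
apply: (chart_transport i01 PX ch iI bab bab').
- move=> G /jI[I1 I2]; have [_ ID IM] := iI.
  by apply: ID; apply: IM.
- move=> G [d1 d10 G0]; apply: G0; first exact: (chart_in ch).
  by rewrite subrr normr0.
- by exists d.
Qed.

Definition chart_dom : set 'rV[R]_n := [set x | exists a b, box a b /\ x = th a b].

Lemma chart_domX : chart_dom `<=` X.
Proof. by move=> _ [a [b [ab ->]]]; exact: (chart_in ch). Qed.

Lemma chart_dom_center : chart_dom p.
Proof.
by exists (pev p u), (pev p g); rewrite (chart_center ch); split=> //; exact: chart_center_box.
Qed.

Lemma chart_dom_open y : chart_dom y -> exists2 d, 0 < d &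
  forall x, X x -> `|x - y| < d -> chart_dom x.
Proof.
move=> [a [b [ab ->]]]; have [d d0 dP] := chart_near ch ab.
exists d => // x Xx xd; have [bx thx] := dP x Xx xd.
by exists (pev x u), (pev x g).
Qed.

Lemma chart_dense F y d : ~ vanishing_ideal chart_dom F -> chart_dom y -> 0 < d ->
  exists x, [/\ chart_dom x, `|x - y| < d & pev x F != 0].
Proof.
move=> VF [a [b [ab ->]]] d0; apply: contrapT => nx; apply: VF.
have [r r0 rP] := chart_dom_open (ex_intro _ a (ex_intro _ b (conj ab erefl))).
have rd0 : 0 < Num.min r d by rewrite lt_min r0.
move=> _ [a' [b' [ab' ->]]]; apply: (chart_identity ab rd0) => // x Xx.
rewrite lt_min => /andP[xr xd]; apply/eqP; apply: contrapT => /negP Fx.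
by apply: nx; exists x; split=> //; exact: rP.
Qed.

(** The nonzero set of a polynomial outside this ideal is open and dense in the chart, so two such
    sets meet. *)
Lemma chart_dom_prime : is_prime (vanishing_ideal chart_dom).
Proof.
split; first exact: vanishing_is_ideal.
  by move=> /(_ p chart_dom_center)/eqP; rewrite meval1 oner_eq0.
move=> F G VFG; apply: contrapT => /not_orP[VF VG].
have [x [Vx _ Fx]] := chart_dense VF chart_dom_center ltr01.
have [d1 d10 dF] := pev_near x F (etrans (normr_gt0 _) Fx).
have [y [Vy yx Gy]] := chart_dense VG Vx d10.
have := VFG y Vy; rewrite mevalM -!pev_meval => /eqP; rewrite mulf_eq0 (negPf Gy) orbF.
apply/negP; apply/eqP => Fy; have := dF y yx.
by rewrite Fy sub0r normrN ltxx.
Qed.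

(** Otherwise [S] vanishes on the chart, and the ideals of [Y], of the chart, of [S'] and of a point
    [s] of [S'] increase strictly. Here [Y] avoids [zeros S] but its ideal lies in that of the
    chart, and [S'] is an infinite part of a coordinate curve. *)
Lemma dense_meets_chart (S : set (mpoly n R)) : has_dimension X 2 ->
  (forall F, (exists2 x, X x & pev x F != 0) ->
     exists x, [/\ X x, pev x F != 0 & ~ zeros S x]) ->
  exists2 x, chart_dom x & ~ zeros S x.
Proof.
move=> [_ dimX] dens; apply: contrapT => nx.
have SV : S `<=` vanishing_ideal chart_dom.
  move=> F SF x Vx; apply: contrapT => Fx; apply: nx; exists x => // zx.
  by apply: Fx; apply: zx.
have [_ V1 VP] := chart_dom_prime.
pose FamY Y := Y `<=` X `&` [set x | ~ zeros S x] /\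
  vanishing_ideal Y `<=` vanishing_ideal chart_dom.
have [|||Y [[YD YV] Yp _]] := @exists_prime_vanishing R n FamY.
- exists (X `&` [set x | ~ zeros S x]); split=> // F YF x Vx.
  rewrite -pev_meval; apply/eqP; apply: contrapT => /negP Fx.
  have [z [Xz /eqP Fz Sz]] := dens F (ex_intro2 _ _ x (chart_domX Vx) Fx).
  by apply: Fz; rewrite pev_meval YF.
- by move=> [_ Y0]; apply: V1; apply: Y0 => x [].
- move=> Y Z [YZD YZV]; apply: contrapT => /not_orP[nY nZ].
  have [F YF nF] : exists2 F, vanishing_ideal Y F & ~ vanishing_ideal chart_dom F.
    apply: contrapT => noF; apply: nY; split=> [x Yx|F YF]; first by apply: YZD; left.
    by apply: contrapT => VF; apply: noF; exists F.
  have [G ZG nG] : exists2 F, vanishing_ideal Z F & ~ vanishing_ideal chart_dom F.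
    apply: contrapT => noG; apply: nZ; split=> [x Zx|G ZG]; first by apply: YZD; right.
    by apply: contrapT => VF; apply: noG; exists G.
  have /YZV/VP[//|//] : vanishing_ideal (Y `|` Z) (F * G).
  by move=> x [/YF|/ZG] E0; rewrite mevalM E0 ?mul0r ?mulr0.
have nVY : ~ vanishing_ideal chart_dom `<=` vanishing_ideal Y.
  move=> VY; have [y Yy] : Y !=set0.
    apply/set0P/eqP => Y0; have [_ Y1 _] := Yp; apply: Y1.
    by rewrite Y0 => x [].
  by have [_ ny] := YD _ Yy; apply: ny => F SF; apply: (VY _ (SV _ SF)).
pose arc := [set x | exists2 b, box (pev p u) b & x = th (pev p u) b].
have arcV : arc `<=` chart_dom by move=> _ [b bb ->]; exists (pev p u), b.
have e0 := chart_gt0 ch.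
have arcI : infinite_set arc.
  (* [k.+2] keeps the increment strictly below [e], already for [k = 0]. *)
  pose f (k : nat) := th (pev p u) (pev p g + e / k.+2%:R).
  have bf k : box (pev p u) (pev p g + e / k.+2%:R).
    split; first by rewrite subrr normr0.
    rewrite addrC addKr ger0_norm ?divr_ge0 ?(ltW e0)// ltr_pdivrMr ?ltr0n//.
    by rewrite ltr_pMr// ltr1n.
  apply: (@infinite_of_injection _ _ f) => [k l|k]; last by exists (pev p g + e / k.+2%:R).
  move=> /(congr1 (fun x => pev x g)); rewrite !(chart_g ch)//.
  move=> /addrI/(mulfI (lt0r_neq0 e0))/invr_inj/eqP; rewrite eqr_nat => /eqP.
  by case.
have [FA0 FAe FAU] := infinite_family arcI.
have [S' [[S'inf S'arc] S'p _]] := exists_prime_vanishing FA0 FAe FAU.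
have [s Ss] := infinite_setN0 S'inf.
have nS's : ~ vanishing_ideal [set s] `<=` vanishing_ideal S'.
  exact: infinite_not_sub_point.
(* [u] is constant on [S'] but not on the chart. *)
have nS'V : ~ vanishing_ideal S' `<=` vanishing_ideal chart_dom.
  move=> /(_ (u - mpolyC n (pev p u))) VS.
  have bx : box (pev p u + e / 2) (pev p g).
    split; last by rewrite subrr normr0.
    by rewrite addrC addKr ger0_norm ?divr_ge0 ?(ltW e0)// ltr_pdivrMr// ltr_pMr// ltr1n.
  have /VS/(_ (th (pev p u + e / 2) (pev p g))) :
      vanishing_ideal S' (u - mpolyC n (pev p u)).
    move=> x /S'arc[b bb ->]; rewrite -pev_meval pevB pevC (chart_u ch)// subrr//.
  move=> h; have /h : chart_dom (th (pev p u + e / 2) (pev p g)).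
    by exists (pev p u + e / 2), (pev p g).
  rewrite -pev_meval pevB pevC (chart_u ch bx) addrC addKr => /eqP.
  by rewrite mulf_eq0 invr_eq0 (gt_eqF e0) pnatr_eq0.
pose c (i : nat) := match i with 0 => vanishing_ideal Y | 1 => vanishing_ideal chart_dom
  | 2 => vanishing_ideal S' | _ => vanishing_ideal [set s] end%N.
have cp i : is_prime (c i).
  by case: i => [|[|[|i]]] //=; [exact: chart_dom_prime|exact: vanishing_point_prime].
have cS i : (i < 3)%N -> c i `<` c i.+1.
  case: i => [|[|[|i]]] //= _; split=> //.
    by apply: vanishing_sub => x /S'arc/arcV.
  by apply: vanishing_sub => _ ->.
have clt i j : (i < j)%N -> (j < 4)%N -> c i `<` c j.
  elim: j => // j IH; rewrite ltnS leq_eqVlt => /predU1P[->|ij] j4; first exact: cS.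
  have [s1 s2] := IH ij (ltnW j4); have [s3 s4] := cS j j4.
  by split=> [x /s1/s3//|H]; apply: s4 => x /H/s1.
suff /dimX : prime_chain X (fun i : 'I_4 => c i) by [].
split=> [i|i j ij]; last exact: clt.
have [k1 k2] := is_prime_closed (cp i); split=> //.
have cXi : vanishing_ideal X `<=` c 0%N by apply: vanishing_sub => x /YD[].
case: i {k1 k2} => -[|i] i4 //= x /cXi; have [+ _] := clt 0%N i.+1 isT i4; exact.
Qed.
End chart_domain.

(** * Good points *)

Section good_points.
Variables (R : realType) (n : nat) (X : set 'rV[R]_n).
Variables (i0 i1 : 'I_n) (P : 'I_n -> mpoly n R).
Hypothesis i01 : i0 != i1.
Hypothesis PX : forall i, i != i0 -> i != i1 -> vanishing_ideal X (P i).
Variables (r : nat) (f : 'I_r -> 'rV[R]_n -> R).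
Hypothesis fcont : forall i q eps, X q -> 0 < eps -> exists2 d, 0 < d &
  forall y, X y -> `|y - q| < d -> `|f i y - f i q| < eps.
Implicit Types (F G W Q : mpoly n R) (x y z p q : 'rV[R]_n) (d eps : R).
Local Notation jac := (jac i0 i1 P).

Definition near_on q (A : set 'rV[R]_n) : Prop :=
  exists2 d, 0 < d & forall y, X y -> `|y - q| < d -> A y.

Definition dense_at q (A : set 'rV[R]_n) : Prop :=
  near_on q [set y | forall eps, 0 < eps -> exists z, [/\ X z, `|z - y| < eps & A z]].

(* At a good point the line spanned by [(f 1, ..., f r)] has a limit, unless
   all the [f i] vanish identically nearby. *)
Definition has_ratio q : Prop :=
  dense_at q [set z | exists i, f i z != 0] /\
  exists k (c : 'I_r -> R), forall eps, 0 < eps -> near_on q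
    [set y | forall i, `|f i y - c i * f k y| <= eps * `|f k y|].

Definition good_at q : Prop :=
  near_on q [set y | forall i, f i y = 0] \/ has_ratio q.

Lemma near_onI q (A B : set 'rV[R]_n) :
  near_on q A -> near_on q B -> near_on q (A `&` B).
Proof.
move=> [d d0 dA] [d' d'0 dB]; exists (Num.min d d'); first by rewrite lt_min d0.
by move=> y Xy; rewrite lt_min => /andP[y1 y2]; split; [exact: dA|exact: dB].
Qed.

Lemma near_on_sub q (A B : set 'rV[R]_n) : A `<=` B -> near_on q A -> near_on q B.
Proof. by move=> AB [d d0 dA]; exists d => // y Xy yd; apply/AB/dA. Qed.

Lemma near_on_trans q (A : set 'rV[R]_n) :
  near_on q A -> near_on q [set y | near_on y A].
Proof.
move=> [d d0 dA]; have d20 : 0 < d / 2 by rewrite divr_gt0.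
exists (d / 2) => // y Xy yq; exists (d / 2) => // z Xz zy; apply: dA => //.
rewrite -(subrK y z) -addrA (le_lt_trans (ler_normD _ _))//.
by rewrite (splitr d) ltrD.
Qed.

Lemma near_on_pev q F eps : 0 < eps -> near_on q [set y | `|pev y F - pev q F| < eps].
Proof. by move=> eps0; have [d d0 dF] := pev_near q F eps0; exists d => // y _; exact: dF. Qed.

Lemma near_on_pev_neq0 q F : pev q F != 0 -> near_on q [set y | pev y F != 0].
Proof.
move=> Fq; apply: near_on_sub (near_on_pev q F (etrans (normr_gt0 _) Fq)) => y /=.
by apply: contraTneq => ->; rewrite sub0r normrN ltxx.
Qed.

Lemma dense_atI q F G :
  dense_at q [set z | pev z F != 0] -> dense_at q [set z | pev z G != 0] ->
  dense_at q [set z | pev z F != 0 /\ pev z G != 0].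
Proof.
move=> dF /near_on_trans dG; apply: near_on_sub (near_onI dF dG) => y [Fy [d d0 Gy]].
move=> eps eps0 /=.
have [|z [Xz + Fz]] := Fy (Num.min (eps / 2) d); first by rewrite lt_min divr_gt0.
rewrite lt_min => /andP[zy zd].
have [h h0 hP] := near_on_pev_neq0 Fz.
have [|w [Xw + Gw]] := Gy z Xz zd (Num.min h (eps / 2)).
  by rewrite lt_min h0 divr_gt0.
rewrite lt_min => /andP[wh we]; exists w; split=> //; last by split=> //; exact: hP.
rewrite -(subrK z w) -addrA (le_lt_trans (ler_normD _ _))//.
by rewrite (splitr eps) ltrD.
Qed.

(** Dividing by [Q] turns the estimate for the numerators into one for [f] where [W] and [Q] are
    nonzero; density and continuity of [f] extend it to all nearby points. *)
Lemma ratio_good q k (c : 'I_r -> R) W Q (Pf : 'I_r -> mpoly n R) :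
  near_on q [set y | forall i, pev y Q * f i y = pev y (Pf i)] ->
  dense_at q [set z | pev z Q != 0] -> dense_at q [set z | pev z W != 0] ->
  (forall eps, 0 < eps -> near_on q [set y | pev y W != 0 -> pev y (Pf k) != 0 /\
    forall i, `|pev y (Pf i) - c i * pev y (Pf k)| <= eps * `|pev y (Pf k)|]) ->
  has_ratio q.
Proof.
move=> Qf dQ dW ratio; have dWQ := dense_atI dW dQ.
have key eps : 0 < eps -> near_on q [set z | pev z W != 0 /\ pev z Q != 0 ->
    f k z != 0 /\ forall i, `|f i z - c i * f k z| <= eps * `|f k z|].
  move=> eps0; apply: near_on_sub (near_onI (ratio eps eps0) Qf) => z [zr zQ] [Wz Qz].
  have [Pk Pi] := zr Wz.
  have fk : f k z != 0.
    by apply: contraNneq Pk => fk0; rewrite -zQ fk0 mulr0.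
  split=> // i; rewrite -(ler_pM2l (_ : 0 < `|pev z Q|)) ?normr_gt0//.
  by rewrite -normrM mulrBr mulrCA !zQ mulrCA -normrM zQ.
split.
  have [d d0 dP] := near_on_trans (key 1 ltr01).
  apply: near_on_sub (near_onI dWQ (ex_intro2 _ _ d d0 dP)) => y [yd [h h0 hP]] eps eps0.
  have [|z [Xz + WQz]] := yd (Num.min eps h); first by rewrite lt_min eps0.
  rewrite lt_min => /andP[zy zh]; exists z; split=> //; exists k.
  by have [] := hP z Xz zh WQz.
exists k, c => eps eps0.
have [d d0 dP] := near_on_trans (key eps eps0); have [d1 d10 dP1] := dWQ.
exists (Num.min d d1) => [|y Xy]; first by rewrite lt_min d0.
rewrite lt_min => /andP[yd yd1] i.
have [h h0 hP] := dP y Xy yd; have yWQ := dP1 y Xy yd1.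
apply/ler_addgt0Pr => t t0.
(* Chosen so that the three error terms [s], [|c i| * s] and [eps * s] add up to [t]. *)
pose s := t / (1 + `|c i| + eps).
have den0 : 0 < 1 + `|c i| + eps by rewrite addr_gt0// ltr_pwDl.
have s0 : 0 < s by rewrite divr_gt0.
have [h1 h10 fi] := fcont i Xy s0; have [h2 h20 fk] := fcont k Xy s0.
have [|z [Xz + WQz]] := yWQ (Num.min h (Num.min h1 h2)).
  by rewrite !lt_min h0 h10.
rewrite !lt_min => /andP[zh /andP[zh1 zh2]].
have [_ /(_ i) zi] := hP z Xz zh WQz.
have fi' := fi z Xz zh1; have fk' := fk z Xz zh2.
have -> : f i y - c i * f k y =
    - (f i z - f i y) + c i * (f k z - f k y) + (f i z - c i * f k z) by ring.
have fkz : `|f k z| <= `|f k y| + s.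
  by rewrite -[X in `|X|](subrK (f k y)) (le_trans (ler_normD _ _))// addrC lerD2l ltW.
rewrite (le_trans (ler_normD _ _))//.
rewrite (_ : eps * _ + t = (s + `|c i| * s) + eps * (`|f k y| + s)); last first.
  by rewrite -[t](divfK (lt0r_neq0 den0)) -/s; ring.
apply: lerD; last by rewrite (le_trans zi)// ler_pM2l.
rewrite (le_trans (ler_normD _ _))//; apply: lerD; first by rewrite normrN ltW.
by rewrite normrM ler_wpM2l// ltW.
Qed.

Lemma near_on_forall (T : finType) q (A : T -> set 'rV[R]_n) :
  (forall i, near_on q (A i)) -> near_on q [set y | forall i, A i y].
Proof.
move=> nA; suff : near_on q [set y | forall i, i \in enum T -> A i y].
  by apply: near_on_sub => y Ay i; apply: Ay; rewrite mem_enum.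
elim: (enum T) => [|i s IH]; first by exists 1.
apply: near_on_sub (near_onI (nA i) IH) => y [Ai As] j.
by rewrite inE => /predU1P[->|/As].
Qed.

(** The difference on the left vanishes at [q], while [|G|] stays above half its value there. *)
Lemma near_on_ratio q (F : 'I_r -> mpoly n R) G eps : pev q G != 0 -> 0 < eps ->
  near_on q [set y | pev y G != 0 /\
    forall i, `|pev y (F i) - pev q (F i) / pev q G * pev y G| <= eps * `|pev y G|].
Proof.
move=> Gq eps0; have Gq0 : 0 < `|pev q G| by rewrite normr_gt0.
have Gq2 : 0 < `|pev q G| / 2 by rewrite divr_gt0.
pose H i := F i - mpolyC n (pev q (F i) / pev q G) * G.
have H0 i : pev q (H i) = 0 by rewrite pevB pevM pevC divfK ?subrr.
have eG : 0 < eps * (`|pev q G| / 2) by rewrite mulr_gt0.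
have nH := near_on_forall (fun i => near_on_pev q (H i) eG).
apply: near_on_sub (near_onI (near_on_pev q G Gq2) nH) => y [Gy Hy].
have Gy2 : `|pev q G| / 2 < `|pev y G|.
  move: Gy => /=; rewrite distrC => h.
  have := ler_normD (pev q G - pev y G) (pev y G); rewrite subrK => h'.
  by rewrite -(ltrD2l (`|pev q G| / 2)) -splitr (le_lt_trans h')// ltrD2r.
split=> [|i]; first by rewrite -normr_gt0 (lt_trans _ Gy2).
have := Hy i; rewrite /= H0 subr0 /H pevB pevM pevC => h.
by rewrite (le_trans (ltW h))// ler_pM2l// ltW.
Qed.

Section fiberwise.
Variables (q : 'rV[R]_n) (s g : mpoly n R) (e : R) (th : R -> R -> 'rV[R]_n) (K : R).
Hypothesis ch : chart X i0 i1 P q s g e th K.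
Hypothesis gq : pev q g = 0.
Local Notation box := (box q s g e).

Lemma fiber_box a b : box a b -> box a 0.
Proof. by case=> ba bb; split=> //; rewrite gq subrr normr0 (chart_gt0 ch). Qed.

(** On a fibre of [s] only [g] varies, so differentiation along it is [jac _ s] divided by
    [jac g s]; the segment starts on the curve [g = 0]. *)
Lemma fiber_derive F a b (t : R) : t \in `[0, 1]%R -> box a b ->
  is_derive t 1 (fun t => pev (th a (t * b)) F)
    (b * pev (th a (t * b)) (jac F s) / pev (th a (t * b)) (jac g s)).
Proof.
move=> t01 bab; have bt : box (a + t * 0) (0 + t * b).
  have := box_segment ch t01 (fiber_box bab) bab; by rewrite subrr subr0.
have := chart_derive i01 PX ch F bt.
rewrite (_ : (fun t => pev (th (a + t * 0) (0 + t * b)) F) =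
             (fun t => pev (th a (t * b)) F)); last first.
  by apply/funext => t'; rewrite mulr0 addr0 add0r.
rewrite !mulr0 addr0 add0r mul0r add0r.
rewrite (jacC P i01 s F) (jacC P i01 s g) !pevN.
by rewrite mulrN invrN mulrNN.
Qed.

Lemma dense_level_set : dense_at q [set z | pev z g != 0].
Proof.
have bq := chart_center_box ch; have := chart_near ch bq.
rewrite (chart_center ch) => -[d d0 dP]; exists d => // y Xy yd eps eps0.
have [by_ thy] := dP y Xy yd.
have [gy|gy] := eqVneq (pev y g) 0; last first.
  by exists y; split=> //; rewrite subrr normr0.
have [h h0 hP] := chart_small ch by_ eps0.
have [||bz thz] := hP (pev y s) (pev y g + h / 2).
- by rewrite subrr normr0.
- by rewrite addrC addKr ger0_norm ?divr_ge0 ?(ltW h0)// ltr_pdivrMr// ltr_pMr// ltr1n.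
exists (th (pev y s) (pev y g + h / 2)); split; first exact: (chart_in ch).
  by rewrite -{3}thy.
by rewrite /= (chart_g ch bz) gy add0r mulf_neq0// ?gt_eqF// invr_eq0 pnatr_eq0.
Qed.

Let D F := jac F s.

(* Repeated use of Cauchy's mean value theorem on the fibres of [s], from the
   curve [g = 0] on which all derivatives of order at most [m] vanish. *)
Lemma fiberwise_ratio (F : 'I_r -> mpoly n R) k m eps : 0 < eps ->
  g = iter m D (F k) -> pev q (iter m.+1 D (F k)) != 0 ->
  (forall j i a, (j <= m)%N -> box a 0 -> pev (th a 0) (iter j D (F i)) = 0) ->
  near_on q [set y | pev y g != 0 -> pev y (F k) != 0 /\
    forall i, `|pev y (F i) - pev q (iter m.+1 D (F i)) / pev q (iter m.+1 D (F k)) *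
       pev y (F k)| <= eps * `|pev y (F k)|].
Proof.
move=> eps0 gE Dq vanish.
pose c i := pev q (iter m.+1 D (F i)) / pev q (iter m.+1 D (F k)).
have bq := chart_center_box ch.
have [d d0 dP] := near_on_ratio (fun i => iter m.+1 D (F i)) Dq eps0.
have [h h0 hP] := chart_small ch bq d0; rewrite (chart_center ch) gq in hP.
(* Descending induction on [j], with the same constants [c i] at every level; at the top level the
   denominator is nonzero at [q] and [near_on_ratio] applies. *)
have level j : (j <= m.+1)%N -> forall a b, `|a - pev q s| < h -> `|b| < h -> b != 0 ->
    pev (th a b) (iter j D (F k)) != 0 /\ forall i,
    `|pev (th a b) (iter j D (F i)) - c i * pev (th a b) (iter j D (F k))| <=
      eps * `|pev (th a b) (iter j D (F k))|.
  move=> jm; rewrite -(subKn jm); elim: (m.+1 - j)%N (leq_subr j m.+1) => [|l IH] lm a b ah bh b0.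
    rewrite subn0; have [|bab thd] := hP a b ah; first by rewrite subr0.
    exact: (dP _ (chart_in ch bab) thd).
  rewrite -(subnSK lm) in IH.
  set j' := (m.+1 - l.+1)%N in IH *.
  have j'm : (j' <= m)%N by rewrite /j' subSS leq_subr.
  have {}IH := IH (ltnW lm).
  have [|bab _] := hP a b ah; first by rewrite subr0.
  have ba0 := fiber_box bab.
  have intb t : t \in `]0, 1[%R -> `|t * b| < h /\ t * b != 0.
    rewrite in_itv /= => /andP[t0 t1]; split; last by rewrite mulf_neq0// gt_eqF.
    by rewrite normrM gtr0_norm// (le_lt_trans _ bh)// ler_piMl// ltW.
  pose w t := pev (th a (t * b)) (iter j' D (F k)).
  pose dw t := b * pev (th a (t * b)) (D (iter j' D (F k))) / pev (th a (t * b)) (jac g s).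
  have dwP (t : R) : t \in `[0, 1]%R -> is_derive t 1 w (dw t).
    by move=> t01; apply: fiber_derive.
  have w0 : w 0 = 0 by rewrite /w mul0r vanish.
  have w1 : w 1 = pev (th a b) (iter j' D (F k)) by rewrite /w mul1r.
  have dw0 (t : R) : t \in `]0, 1[%R -> dw t != 0.
    move=> t01; have [tb tb0] := intb t t01.
    have [Dt _] := IH a (t * b) ah tb tb0.
    have t01' := subset_itv_oo_cc t01.
    have bt : box a (t * b).
      by have := box_segment ch t01' ba0 bab; rewrite subrr subr0 mulr0 addr0 add0r.
    rewrite /dw mulf_neq0// ?mulf_neq0// invr_eq0.
    by rewrite (jacC P i01 s g) pevN oppr_eq0 (chart_jac ch).
  have oc (t : R) : t \in `]0, 1[%R -> t \in `[0, 1]%R by move=> h'; apply: subset_itv_oo_cc h'.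
  have dwo (t : R) : t \in `]0, 1[%R -> is_derive t 1 w (dw t) by move=> /oc/dwP.
  have cw := is_derive_within_continuous dwP.
  split.
    have := differentiable_subr_neq0 ltr01 cw dwo dw0.
    by rewrite w0 subr0 w1.
  move=> i.
  pose H := iter j' D (F i) - mpolyC n (c i) * iter j' D (F k).
  pose v t := pev (th a (t * b)) H.
  pose dv t := b * pev (th a (t * b)) (D H) / pev (th a (t * b)) (jac g s).
  have dvP (t : R) : t \in `[0, 1]%R -> is_derive t 1 v (dv t).
    by move=> t01; apply: fiber_derive.
  have dvo (t : R) : t \in `]0, 1[%R -> is_derive t 1 v (dv t) by move=> /oc/dvP.
  have cv := is_derive_within_continuous dvP.
  have v0 : v 0 = 0 by rewrite /v mul0r pevB pevM !vanish// mulr0 subrr.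
  have v1 : v 1 = pev (th a b) (iter j' D (F i)) - c i * pev (th a b) (iter j' D (F k)).
    by rewrite /v mul1r pevB pevM pevC.
  (* Both functions vanish at 0, so [v 1 / w 1] is a quotient of derivatives at an intermediate
     point of the fibre, where the common factor [b / jac g s] cancels. *)
  have [t t01 tE] := cauchy_MVT ltr01 cv cw dvo dwo dw0.
  have [tb tb0] := intb t t01.
  have [Dt /(_ i) Dti] := IH a (t * b) ah tb tb0.
  have t01' := oc t t01.
  have bt : box a (t * b).
    by have := box_segment ch t01' ba0 bab; rewrite subrr subr0 mulr0 addr0 add0r.
  have wn0 : w 1 != 0.
    by have := differentiable_subr_neq0 ltr01 cw dwo dw0; rewrite w0 subr0.
  rewrite -v1 -w1.
  have Jn0 : pev (th a (t * b)) (jac g s) != 0.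
    by rewrite (jacC P i01 s g) pevN oppr_eq0 (chart_jac ch).
  have DH : D H = D (iter j' D (F i)) - mpolyC n (c i) * D (iter j' D (F k)).
    rewrite /D; have [E EE] := jac_vfieldl i0 i1 P s.
    by rewrite !EE /H -mulNr -mpolyCN vfieldD vfieldM vfieldC mul0r add0r mpolyCN mulNr.
  have quot (x1 x2 x3 : R) : b != 0 -> x3 != 0 -> (b * x1 / x3) / (b * x2 / x3) = x1 / x2.
    move=> b1 x30; have [->|x20] := eqVneq x2 0; first by rewrite mulr0 mul0r !invr0 !mulr0.
    by field; rewrite x20 x30 b1.
  move: tE; rewrite w0 v0 !subr0 /dv /dw quot// => tE.
  have -> : v 1 = pev (th a (t * b)) (D H) / pev (th a (t * b)) (D (iter j' D (F k))) * w 1.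
    by rewrite tE divfK.
  rewrite normrM ler_wpM2r// normrM normfV ler_pdivrMr ?normr_gt0//.
  by rewrite DH pevB pevM pevC.
have [d1 d10 d1P] := chart_near ch bq; rewrite (chart_center ch) in d1P.
apply: near_on_sub (near_onI (near_onI (near_on_pev q s h0) (near_on_pev q g h0))
  (ex_intro2 _ _ d1 d10 d1P)) => y [[/= ys yg] [by_ thy]] gy.
rewrite gq subr0 in yg.
by have := level 0%N isT (pev y s) (pev y g) ys yg gy; rewrite /= thy.
Qed.
End fiberwise.
End good_points.

(** * Bad points are isolated *)

Section isolated_bad_points.
Variables (R : realType) (n : nat) (X : set 'rV[R]_n).
Variables (i0 i1 : 'I_n) (P : 'I_n -> mpoly n R).
Hypothesis i01 : i0 != i1.
Hypothesis PX : forall i, i != i0 -> i != i1 -> vanishing_ideal X (P i).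
Implicit Types (F G W Q : mpoly n R) (x y z q : 'rV[R]_n) (d eps : R).
Local Notation jac := (jac i0 i1 P).

(** Leibniz' rule. This ideal, stable under [jac _ s] by construction, is fed to
    [chart_transport]. *)
Lemma iter_jac_ideal p s :
  is_ideal [set G | forall l, pev p (iter l (fun F => jac F s) G) = 0].
Proof.
have [E EE] := jac_vfieldl i0 i1 P s.
have iE l G : iter l (fun F => jac F s) G = iter l (vfield E) G.
  by elim: l => //= l ->.
have iD l F G : iter l (vfield E) (F + G) = iter l (vfield E) F + iter l (vfield E) G.
  by elim: l => //= l ->; rewrite vfieldD.
split=> [l|F G F0 G0 l|F G G0 l].
- rewrite iE (_ : iter l _ 0 = 0) ?pev0//.
  by elim: l => //= l ->; rewrite vfield0.
- by rewrite iE iD pevD -!iE F0 G0 addr0.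
rewrite iE; elim: l F G G0 => [|l IH] F G G0 /=.
  by rewrite pevM (G0 0%N) mulr0.
rewrite -iterS iterSr vfieldM iD pevD IH// IH ?addr0// => k.
by have := G0 k.+1; rewrite !iE iterSr.
Qed.

(** For each target [(a, b)] the chosen [s] is constant along the segment from the centre, so
    [jac _ s] differentiates along it. If all iterates vanished at [p], transport would make [F]
    vanish at every target. *)
Lemma transverse_order p u g e th K F : chart X i0 i1 P p u g e th K ->
  ~ vanishing_ideal (chart_dom p u g e th) F ->
  exists s l, pev p (iter l (fun G => jac G s) F) != 0.
Proof.
move=> ch VF; apply: contrapT => nsl; apply: VF => _ [a [b [bab ->]]].
pose s := mpolyC n (a - pev p u) * g + mpolyC n (pev p g - b) * u.
have Fs l : pev p (iter l (fun G => jac G s) F) = 0.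
  by apply/eqP; apply: contrapT => /negP h; apply: nsl; exists s, l.
rewrite -pev_meval.
apply: (chart_transport i01 PX ch (iter_jac_ideal p s) (chart_center_box ch) bab) => //.
  move=> G G0 l; suff -> : mpolyC n (a - pev p u) * jac G g +
      mpolyC n (b - pev p g) * jac u G = jac G s by rewrite -iterSr; exact: G0.
  have [E EE] := jac_vfieldr P i01 G.
  rewrite (jacC P i01 G u) !EE /s vfieldD !vfieldM !vfieldC !mul0r !add0r.
  by rewrite -[pev p g - b]opprB mpolyCN; ring.
by move=> G /(_ 0%N) /=; rewrite (chart_center ch).
Qed.

Variables (r : nat) (f : 'I_r -> 'rV[R]_n -> R).
Hypothesis fcont : forall i q eps, X q -> 0 < eps -> exists2 d, 0 < d &
  forall y, X y -> `|y - q| < d -> `|f i y - f i q| < eps.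

Section at_a_point.
Variables (p : 'rV[R]_n) (u g : mpoly n R) (e : R) (th : R -> R -> 'rV[R]_n) (K : R).
Hypotheses (ch : chart X i0 i1 P p u g e th K) (locp : loc_eq X i0 i1 P p).
Local Notation V := (chart_dom p u g e th).
Variables (Q : mpoly n R) (Pf : 'I_r -> mpoly n R).
Hypothesis VQ : ~ vanishing_ideal V Q.
Hypothesis Qf : forall y i, V y -> pev y Q * f i y = pev y (Pf i).

Lemma null_near : (forall i, vanishing_ideal V (Pf i)) ->
  forall y i, V y -> f i y = 0.
Proof.
move=> VPf y i Vy; apply/eqP; apply: contrapT => /negP fy.
have [d d0 dP] := fcont i (chart_domX ch Vy) (etrans (normr_gt0 _) fy).
have [z [Vz zy Qz]] := chart_dense i01 PX ch VQ Vy d0.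
have := dP z (chart_domX ch Vz) zy.
have -> : f i z = 0.
  by apply: (mulfI Qz); rewrite Qf// mulr0; exact: VPf.
by rewrite sub0r normrN ltxx.
Qed.

Lemma near_chart_data q : V q ->
  near_on X q [set y | forall i, pev y Q * f i y = pev y (Pf i)] /\
  dense_at X q [set z | pev z Q != 0].
Proof.
move=> Vq; have [d d0 dV] := chart_dom_open ch Vq; split.
  by exists d => // y Xy yq i; apply: Qf; exact: dV.
exists d => // y Xy yq eps eps0.
have [z [Vz zy Qz]] := chart_dense i01 PX ch VQ (dV y Xy yq) eps0.
by exists z; split=> //; exact: (chart_domX ch).
Qed.

Lemma nonvanishing_good q k : V q -> pev q (Pf k) != 0 -> good_at X f q.
Proof.
move=> Vq Pk; right; have [nQ dQ] := near_chart_data Vq.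
apply: (@ratio_good _ _ X _ _ fcont q k
  (fun i => pev q (Pf i) / pev q (Pf k)) (Pf k) Q Pf) => //.
  have [d d0 dP] := near_on_pev_neq0 X Pk.
  exists d => // y Xy yq eps eps0; exists y; split=> //; first by rewrite subrr normr0.
  exact: dP.
by move=> eps eps0; apply: near_on_sub (near_on_ratio X Pf Pk eps0) => y h _.
Qed.

Lemma finite_bad_points s k l (B : set 'rV[R]_n) :
  (forall q, B q -> [/\ V q, loc_eq X i0 i1 P q, ~ good_at X f q &
     pev q (iter l (fun F => jac F s) (Pf k)) != 0]) -> finite_set B.
Proof.
move=> BP; apply: contrapT => Binf.
pose D F := jac F s.
have [FA0 FAe FAU] := infinite_family Binf.
have [S [[Sinf SB] Sp Smin']] := exists_prime_vanishing FA0 FAe FAU.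
have Smin Z : infinite_set Z -> Z `<=` S -> vanishing_ideal Z `<=` vanishing_ideal S.
  by move=> Zinf ZS; apply: Smin' => //; split=> // z /ZS/SB.
have VX : vanishing_ideal X `<=` vanishing_ideal S.
  by apply: vanishing_sub => q /SB/BP[/(chart_domX ch)].
have generic F : ~ vanishing_ideal S F -> exists2 q, S q & pev q F != 0.
  move=> SF; apply: contrapT => nq; apply: SF => q Sq; apply: contrapT => /eqP Fq.
  by apply: nq; exists q.
(* The order [l] at the points of [B] shows that some derivative is outside the ideal of [S]; the
   least such order [m] puts all lower derivatives inside. *)
have ex : exists m, `[< exists j, ~ vanishing_ideal S (iter m D (Pf j)) >].
  exists l; apply/asboolP; exists k => /= Sk; have [q Sq] := infinite_setN0 Sinf.
  by have [_ _ _ /eqP] := BP q (SB q Sq); apply; rewrite pev_meval; exact: Sk.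
case: (ex_minnP ex) => m /asboolP[j Sj] mmin.
have below i m' : (m' < m)%N -> vanishing_ideal S (iter m' D (Pf i)).
  move=> m'm; apply: contrapT => h.
  by have := mmin m' ltac:(by apply/asboolP; exists i); rewrite leqNgt m'm.
have [q Sq qj] := generic _ Sj.
have [Vq locq nbad _] := BP q (SB q Sq).
(* For [m = 0] a numerator is nonzero at [q], which is then good at once. *)
case: m => [|m] in mmin below Sj qj ex *; first exact: nbad (nonvanishing_good Vq qj).
pose G := iter m D (Pf j).
have SG : vanishing_ideal S G by exact: below.
have Gq : pev q G = 0 by rewrite pev_meval SG.
have sG : pev q (jac s G) != 0 by rewrite (jacC P i01 G s) pevN oppr_eq0.
have [inv|/existsNP[H /not_implyP[SH SHG]]] :=
    pselect (forall F, vanishing_ideal S F -> vanishing_ideal S (jac F G)); last first.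
  (* All members of the frame of [H] and [G] lie in the ideal of [S], hence so does their Jacobian
     determinant [jac H G]. *)
  apply: SHG; rewrite jacE; apply: det_gradient_in_ideal => // i.
  have [->|ii0] := eqVneq i i0; first by rewrite frame0.
  have [->|ii1] := eqVneq i i1; first by rewrite frame1.
  by rewrite frame2//; apply: VX; exact: PX.
have Xq := chart_domX ch Vq.
(* [s] and [G] are coordinates at [q]: up to sign their bracket is [iter m.+1 D (Pf j)], which is
   nonzero there. *)
have [e' [th' [K' [ch' _]]]] := chart_exists i01 PX Xq locq sG ltr01.
apply: nbad; right; have [nQ dQ] := near_chart_data Vq.
apply: (@ratio_good _ _ X _ _ fcont q j
  (fun i => pev q (iter m.+1 D (Pf i)) / pev q (iter m.+1 D (Pf j))) G Q Pf) => //.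
  exact: (dense_level_set ch').
move=> eps eps0; apply: (fiberwise_ratio i01 PX ch' Gq eps0) => // m' i a m'm ba.
have bq := chart_center_box ch'; rewrite Gq in bq.
(* The ideal of [S], stable under [jac _ G], vanishes at [q] and is transported along the curve
   [G = 0]. *)
apply: (chart_transport i01 PX ch' (vanishing_is_ideal S) bq ba); last exact: below.
  move=> F SF; have [_ SD SM] := vanishing_is_ideal S.
  rewrite subrr mpolyC0 mul0r addr0; apply: SM; exact: inv.
by move=> F SF; rewrite -Gq (chart_center ch') pev_meval SF.
Qed.

(** Unless all numerators vanish on the chart, one derivative of fixed order is nonzero at [p],
    hence near [p]; the bad points there are finite in number and can be avoided by shrinking. *)
Lemma good_punctured : exists2 d, 0 < d &
  forall q, X q -> `|q - p| < d -> q != p -> good_at X f q.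
Proof.
have [d d0 dV] := chart_dom_open ch (chart_dom_center ch).
have [VPf|/existsNP[k VPk]] := pselect (forall i, vanishing_ideal V (Pf i)).
  exists d => // q Xq qp _; left; have [d' d'0 d'V] := chart_dom_open ch (dV q Xq qp).
  by exists d' => // y Xy yq i; apply: null_near => //; exact: d'V.
have [s [l Dp]] := transverse_order ch VPk.
have [d1 d10 d1P] := near_on_pev_neq0 X Dp.
have [d2 d20 d2P] := loc_eq_near locp.
pose m := Num.min d (Num.min d1 d2).
have m0 : 0 < m by rewrite !lt_min d0 d10.
pose B := [set q | [/\ X q, `|q - p| < m & ~ good_at X f q]].
have finB : finite_set B.
  apply: (@finite_bad_points s k l) => q [Xq].
  rewrite !lt_min => /andP[qd /andP[qd1 qd2]] bad.
  by split=> //; [exact: dV|exact: d2P|exact: d1P].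
have [h h0 hP] : exists2 h, 0 < h & forall q, B q -> q != p -> h <= `|q - p|.
  have /finite_seqP[t tE] := finB.
  have [h h0 hP] : exists2 h, 0 < h & forall q, q \in t -> q != p -> h <= `|q - p|.
    elim: t {tE} => [|q t [h h0 IH]]; first by exists 1.
    have [->|qp] := eqVneq q p.
      by exists h => // q'; rewrite inE => /predU1P[->|/IH//]; rewrite eqxx.
    exists (Num.min h `|q - p|); first by rewrite lt_min h0 normr_gt0 subr_eq0.
    move=> q'; rewrite inE ge_min => /predU1P[->|/IH h'] q'p.
      by rewrite lexx orbT.
    by rewrite h'.
  by exists h => // q; rewrite tE; exact: hP.
exists (Num.min m h) => [|q Xq]; first by rewrite lt_min m0.
rewrite lt_min => /andP[qm qh] qp; apply: contrapT => bad.
by have := hP q (And3 Xq qm bad) qp; rewrite leNgt qh.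
Qed.
End at_a_point.
End isolated_bad_points.

(** * Charts at nonsingular points *)

Lemma row_free_completion (F : fieldType) m k (A : 'M[F]_(m, m + k)) :
  row_free A -> exists B : 'M[F]_(k, m + k), col_mx A B \in unitmx.
Proof.
move=> /eqP rA; pose C := col_ebase A; pose E := row_ebase A.
(* [A] is an invertible matrix times the first rows of the invertible [E]; the remaining rows
   complete it. *)
exists (dsubmx E).
have AE : A = C *m usubmx E.
  rewrite -[LHS]mulmx_ebase rA -/C -/E -mulmxA; congr (_ *m _).
  by rewrite pid_mx_row -{1}[E]vsubmxK mul_row_col mul1mx mul0mx addr0.
have -> : col_mx A (dsubmx E) = block_mx C 0 0 1%:M *m E.
  by rewrite -{2}[E]vsubmxK mul_block_col !mul0mx mul1mx addr0 add0r -AE.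
rewrite unitmx_mul row_ebase_unit andbT unitmxE det_ublock det1 mulr1 -unitmxE.
exact: col_ebase_unit.
Qed.

(** The gradients of the equations are completed to a basis by the rows of [B], whose linear forms
    serve as [u] and [g]. The equations fill the first [m] slots; [i0] and [i1] are the last two. *)
Lemma nonsingular_chart (R : realType) n (X : set 'rV[R]_n) p :
  nonsingular_at X 2 p -> exists (i0 i1 : 'I_n) (P : 'I_n -> mpoly n R), [/\ i0 != i1,
    forall i, i != i0 -> i != i1 -> vanishing_ideal X (P i), loc_eq X i0 i1 P p &
    exists u g, pev p (jac i0 i1 P u g) != 0].
Proof.
case=> m [P [U [mn]]]; subst n => PX Pfree Up XU.
pose i0 : 'I_(m + 2) := rshift m ord0; pose i1 : 'I_(m + 2) := rshift m ord_max.
pose P' (i : 'I_(m + 2)) := if fintype.split i is inl j then P j else 0.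
have P'l j : P' (lshift 2 j) = P j by rewrite /P' (unsplitK (inl j)).
have i01 : i0 != i1 by rewrite (inj_eq (@rshift_inj _ _)).
have li0 j : lshift 2 j != i0 by rewrite eq_lrshift.
have li1 j : lshift 2 j != i1 by rewrite eq_lrshift.
have is_l i : i != i0 -> i != i1 -> exists j, i = lshift 2 j.
  move=> ii0 ii1; case: (split_ordP i) => j ij; first by exists j.
  have j01 : j = ord0 \/ j = ord_max.
    by case: j {ij} => -[|[|//]] ?; [left|right]; exact: val_inj.
  by case: j01 => jE; [case/eqP: ii0|case/eqP: ii1]; rewrite ij jE.
have [B AB] := row_free_completion Pfree.
pose lin (k : 'I_2) : mpoly (m + 2) R := \sum_j mpolyC (m + 2) (B k j) * 'X_j.
exists i0, i1, P'; split=> //.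
- by move=> i ii0 ii1; have [j ->] := is_l i ii0 ii1; rewrite P'l; exact: PX.
- have /nbhs_distP[d d0 dU] := Up; exists d => // x xp P0.
  suff : (X `&` U) x by case.
  rewrite XU; split; last exact: dU.
  by move=> _ [j _ <-]; rewrite -P'l; exact: P0.
exists (lin ord0), (lin ord_max); rewrite pev_jac.
have mlin k j : pev p (mderiv j (lin k)) = B k j.
  rewrite /lin raddf_sum pev_sum (bigD1 j)//= mderivM mderivC mderivXU eqxx mulr1.
  rewrite mul0r add0r pevC big1 ?addr0// => l lj.
  by rewrite mderivM mderivC mderivXU (negPf lj) mulr0 mul0r addr0 pev0.
set M := \matrix_(_, _) _; have -> : M = col_mx (Defs.jacobian P p) B.
  apply/matrixP => i j; rewrite !mxE; case: splitP => k ik.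
    have -> : i = lshift 2 k by exact: val_inj.
    by rewrite frame2// P'l !mxE.
  have -> : i = rshift m k by exact: val_inj.
  have [->|k0] := eqVneq k ord0; first by rewrite frame0 mlin.
  have -> : k = ord_max.
    by apply: val_inj; move: k0; rewrite -val_eqE; case: k {ik} => -[|[|//]].
  by rewrite frame1// mlin.
by move: AB; rewrite unitmxE unitfE.
Qed.

(** * Interpolation and gluing *)

Section interpolation.
Variables (R : realType) (V : normedModType R) (T : topologicalType) (iota : T -> V).
Hypothesis nbhsT : forall (x : T) (A : set T), nbhs x A <->
  exists2 d : R, 0 < d & forall y, `|iota y - iota x| < d -> A y.
Implicit Types x y p : T.

Let dst x y : R := `|iota x - iota y|.

Lemma dstC x y : dst x y = dst y x.
Proof. exact: distrC. Qed.

Lemma dst_tri z x y : dst x y <= dst x z + dst z y.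
Proof. by rewrite /dst -{1}(subrK (iota z) (iota x)) -addrA ler_normD. Qed.

Let bump (rho : R) (p : T) (a : R) (x : T) : R := a * Num.max 0 (1 - dst x p / rho).

Lemma bump_continuous rho p a : continuous (bump rho p a).
Proof.
move=> x; have dc : {for x, continuous (fun y => dst y p)}.
  apply/cvgrPdist_lt => eps eps0; apply/nbhsT; exists eps => // y yx.
  apply: le_lt_trans yx; rewrite distrC.
  have := ler_dist_dist (iota y - iota p) (iota x - iota p).
  by rewrite opprB addrA subrK.
apply: cvgM; first exact: cvg_cst.
apply: (@continuous_max _ _ (fun=> 0) (fun y => 1 - dst y p / rho) x); first exact: cvg_cst.
by apply: cvgB; [exact: cvg_cst|apply: cvgM; [exact: dc|exact: cvg_cst]].
Qed.

(* Bumps of disjoint supports, locally finite because of the factor 3. *)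
Lemma interpolation (B : set T) (w : T -> R) :
  (forall p, \forall q \near p, q <> p -> ~ B q) ->
  exists2 v : T -> R, continuous v & forall p, B p -> v p = w p.
Proof.
move=> iso.
have far1 (d a b t s : R) : d <= a + b -> a < s -> b < t / 2 -> 3 * t <= d -> 3 * s <= d ->
    0 < t -> False by lra.
have far2 (d d' a a' b b' t s s' m : R) : d <= a + b -> d' <= a' + b' -> m <= d + d' ->
    a < s -> a' < s' -> b < t / 2 -> b' < t / 2 -> 3 * t <= d -> 3 * t <= d' ->
    3 * s' <= m -> 3 * s <= m -> 0 < t -> False by lra.
have /choice[rho rhoP] : forall p, exists rho, 0 < rho /\
    forall q, B q -> dst q p < 3 * rho -> q = p.
  move=> p; have /nbhsT[d d0 dP] := iso p; exists (d / 3); split; first by rewrite divr_gt0.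
  move=> q Bq; rewrite mulrC divfK// => qp; apply: contrapT => qnp.
  exact: dP q qp qnp Bq.
have rho0 p : 0 < rho p by have [] := rhoP p.
have sep p q : B q -> dst q p < 3 * rho p -> q = p by have [_] := rhoP p; apply.
pose hit x p := B p /\ dst x p < rho p.
pose v x := if pselect (exists p, hit x p) is left h then
  bump (rho (sval (cid h))) (sval (cid h)) (w (sval (cid h))) x else 0.
(* Within [rho x / 2] of [x] at most one bump is active: two centres, or a centre and [x], would be
   too close for the factor 3. *)
have uniq_near x y y' p p' : dst y x < rho x / 2 -> dst y' x < rho x / 2 ->
    hit y p -> hit y' p' -> p = p'.
  move=> yx yx' [Bp yp] [Bp' yp'].
  have rx := rho0 x; have rp := rho0 p; have rp' := rho0 p'.
  have px : dst p x <= dst y p + dst y x by rewrite (dstC y p); exact: dst_tri.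
  have px' : dst p' x <= dst y' p' + dst y' x by rewrite (dstC y' p'); exact: dst_tri.
  have [ex|nx] := pselect (p = x).
    have [ex'|nx'] := pselect (p' = x); first by rewrite ex ex'.
    have h1 : 3 * rho x <= dst p' x by rewrite leNgt; apply/negP => /(sep _ _ Bp').
    rewrite ex in Bp.
    have h2 : 3 * rho p' <= dst x p'.
      by rewrite leNgt; apply/negP => /(sep _ _ Bp) /esym.
    rewrite dstC in h2; case: (far1 _ _ _ _ _ px' yp' yx' h1 h2 rx).
  have [ex'|nx'] := pselect (p' = x).
    have h1 : 3 * rho x <= dst p x by rewrite leNgt; apply/negP => /(sep _ _ Bp).
    rewrite ex' in Bp'.
    have h2 : 3 * rho p <= dst x p.
      by rewrite leNgt; apply/negP => /(sep _ _ Bp') /esym.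
    rewrite dstC in h2; case: (far1 _ _ _ _ _ px yp yx h1 h2 rx).
  apply: contrapT => npp'.
  have h1 : 3 * rho x <= dst p x by rewrite leNgt; apply/negP => /(sep _ _ Bp).
  have h1' : 3 * rho x <= dst p' x by rewrite leNgt; apply/negP => /(sep _ _ Bp').
  have h2 : 3 * rho p' <= dst p p' by rewrite leNgt; apply/negP => /(sep _ _ Bp).
  have h3 : 3 * rho p <= dst p' p.
    by rewrite leNgt; apply/negP => /(sep _ _ Bp') /esym.
  have h4 : dst p p' <= dst p x + dst p' x by rewrite (dstC p' x); exact: dst_tri.
  rewrite dstC in h3; exact: (far2 _ _ _ _ _ _ _ _ _ _ px px' h4 yp yp' yx yx' h1 h1' h2 h3 rx).
have v_hit x p : hit x p -> v x = bump (rho p) p (w p) x.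
  move=> hp; rewrite /v; case: pselect => [h|]; last by case; exists p.
  case: (cid h) => p' hp' /=; suff -> : p' = p by [].
  have xx : dst x x < rho x / 2 by rewrite /dst subrr normr0 divr_gt0.
  exact: (uniq_near x x x).
have v_nohit x : ~ (exists p, hit x p) -> v x = 0 by rewrite /v; case: pselect.
exists v => [x|p Bp]; last first.
  rewrite (v_hit p p); last by split=> //; rewrite /dst subrr normr0.
  by rewrite /bump /dst subrr normr0 mul0r subr0 max_r// mulr1.
have near_x : \forall y \near x, dst y x < rho x / 2.
  by apply/nbhsT; exists (rho x / 2) => //; rewrite divr_gt0.
have xx : dst x x < rho x / 2 by rewrite /dst subrr normr0 divr_gt0.
have [[y0 [p0 [y0x hy0]]]|nohit] := pselect (exists y p, dst y x < rho x / 2 /\ hit y p).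
  have vE y : dst y x < rho x / 2 -> v y = bump (rho p0) p0 (w p0) y.
    move=> yx; have [[p hp]|nh] := pselect (exists p, hit y p).
      by rewrite (v_hit y p hp) (uniq_near x y y0 p p0).
    rewrite v_nohit// /bump max_l ?mulr0// subr_le0 ler_pdivlMr// mul1r leNgt.
    by apply/negP => yp; apply: nh; exists p0; split=> //; case: hy0.
  rewrite /continuous_at vE//; apply: cvg_trans (@bump_continuous (rho p0) p0 (w p0) x).
  by apply: near_eq_cvg; apply: filterS near_x => y /vE.
have v0 y : dst y x < rho x / 2 -> v y = 0.
  by move=> yx; apply: v_nohit => -[p hp]; apply: nohit; exists y, p.
rewrite /continuous_at v0//; apply: cvg_trans (@cvg_cst _ (0 : R) _ (nbhs x) _).
by apply: near_eq_cvg; apply: filterS near_x => y /v0.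
Qed.
End interpolation.

Lemma ler_mul_sqr (K : realFieldType) (a b s : K) : a ^+ 2 <= s -> b ^+ 2 <= s -> a * b <= s.
Proof. by move=> h1 h2; have := sqr_ge0 (a - b); rewrite sqrrB mulr2n; lra. Qed.

Lemma cvg_sum_ord (R : realType) (T : Type) (F : set_system T) (FF : Filter F)
    n (g : 'I_n -> T -> R) (a : 'I_n -> R) :
  (forall i, g i @ F --> a i) -> (fun x => \sum_(i < n) g i x) @ F --> \sum_(i < n) a i.
Proof.
elim: n g a => [|n IH] g a ga.
  rewrite big_ord0; under eq_fun do rewrite big_ord0; exact: cvg_cst.
rewrite big_ord_recr /=; under eq_fun do rewrite big_ord_recr /=.
by apply: cvgD; [apply: IH => i; exact: ga|exact: ga].
Qed.

(** * Gluing: a continuous solution from isolated bad points *)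

Section assembly.
Variables (R : realType) (T : topologicalType) (r : nat).
Variables (f : 'I_r -> T -> R) (phi : T -> R) (psi : T -> 'I_r -> T -> R).
Hypothesis fcont : forall i, continuous (f i).
Hypothesis phicont : continuous phi.
Hypothesis psicont : forall q i, {for q, continuous (psi q i)}.
Hypothesis psiE : forall q x, phi x = \sum_(i < r) psi q i x * f i x.

Let E := [set x : T | exists i, f i x != 0].
Let sq x := \sum_(i < r) f i x ^+ 2.

Definition null_germ (q : T) : Prop := \forall y \near q, forall i, f i y = 0.

Definition direction_germ (q : T) : Prop :=
  (\forall y \near q, closure E y) /\
  exists k (c : 'I_r -> R), forall eps, 0 < eps ->
    \forall y \near q, forall i, `|f i y - c i * f k y| <= eps * `|f k y|.

Lemma sum_sq_gt0 x : E x -> 0 < sq x.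
Proof.
move=> [k fk]; rewrite /sq (bigD1 k)//= ltr_pwDl//; last by apply: sumr_ge0 => i _; exact: sqr_ge0.
by rewrite lt_def sqrf_eq0 fk sqr_ge0.
Qed.

(** Entries of the orthogonal projection onto the line spanned by [f]; they are 0 where [f]
    vanishes. *)
Let prj i j x := f i x * f j x / sq x.

Lemma prj_le1 i j x : `|prj i j x| <= 1.
Proof.
have [Ex|nE] := pselect (E x); last first.
  have f0 l : f l x = 0.
    by apply/eqP; apply: contrapT => /negP fl; apply: nE; exists l.
  by rewrite /prj f0 !mul0r normr0.
have s0 := sum_sq_gt0 Ex.
rewrite /prj normrM normfV (gtr0_norm s0) ler_pdivrMr// mul1r normrM.
have fi l : `|f l x| ^+ 2 <= sq x.
  rewrite real_normK ?num_real// /sq (bigD1 l)//= lerDl.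
  by apply: sumr_ge0 => m _; exact: sqr_ge0.
exact: ler_mul_sqr.
Qed.

Variables (v : 'I_r -> T -> R).
Hypothesis vcont : forall i, continuous (v i).

Let cE i x := v i x + (phi x - \sum_(j < r) v j x * f j x) * f i x / sq x.

(** Expanding [phi] by the pointwise test at [q] turns the singular quotient into a bounded
    projection applied to a function continuous at [q]. *)
Lemma cE_prj q i x : cE i x = v i x + \sum_(j < r) prj i j x * (psi q j x - v j x).
Proof.
rewrite /cE (psiE q) -sumrB mulr_suml mulr_suml; congr (_ + _).
by apply: eq_bigr => j _; rewrite /prj; ring.
Qed.

Let F (q : T) := within E (nbhs q).

Lemma cvgF q (h : T -> R) : {for q, continuous h} -> h @ F q --> h q.
Proof. by move=> ch; apply: cvg_trans ch; apply: cvg_app; exact: cvg_within. Qed.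

(** The projection depends on the line only: after division by [f k ^+ 2] the denominator tends to a
    sum of squares containing [c k ^+ 2 = 1]. *)
Lemma prj_cvg q : direction_germ q -> exists L : 'I_r -> 'I_r -> R,
  forall i j, prj i j @ F q --> L i j.
Proof.
move=> [cl [k [c rat]]].
have nz : \forall y \near q, E y -> f k y != 0.
  apply: filterS (rat 1 ltr01) => y yr [i fi]; apply: contraNneq fi => fk.
  by have := yr i; rewrite fk mulr0 subr0 normr0 mulr0 normr_le0.
have nzF : \forall y \near F q, f k y != 0 by exact: nz.
pose rho i y := f i y / f k y.
have rhoc i : rho i @ F q --> c i.
  apply/cvgrPdist_le => eps eps0.
  suff h : \forall y \near q, E y -> `|c i - rho i y| <= eps by exact: h.
  apply: filterS (filterI nz (rat eps eps0)) => y [ynz yr] /ynz fk.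
  have fk0 : 0 < `|f k y| by rewrite normr_gt0.
  by rewrite -(ler_pM2r fk0) -normrM mulrBl /rho divfK// distrC.
(* [q] is adherent to [E], and at points of [E] near [q] the estimate for the index [k] can be
   divided by the nonzero [f k]. *)
have ck : c k = 1.
  apply/eqP; rewrite -subr_eq0 -normr_le0; apply/ler_addgt0Pr => eps eps0; rewrite add0r.
  have clq : closure E q by exact: nbhs_singleton cl.
  have [y [Ey [ynz yr]]] := clq _ (filterI nz (rat eps eps0)).
  have fk0 : 0 < `|f k y| by rewrite normr_gt0 ynz.
  rewrite -(ler_pM2r fk0) -normrM mulrBl mul1r distrC; exact: yr.
pose s := \sum_(i < r) c i ^+ 2.
have s0 : s != 0.
  rewrite gt_eqF// /s (bigD1 k)//= ck expr1n ltr_pwDl// sumr_ge0// => i _; exact: sqr_ge0.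
exists (fun i j => c i * c j / s) => i j.
have lim : (fun y => rho i y * rho j y / \sum_(l < r) rho l y ^+ 2) @ F q --> c i * c j / s.
  apply: cvgM; first by apply: cvgM; exact: rhoc.
  apply: cvgV => //; apply: cvg_sum_ord => l.
  rewrite expr2; under eq_fun do rewrite expr2; apply: cvgM; exact: rhoc.
apply: cvg_trans lim; apply: near_eq_cvg; near=> y.
have fk : f k y != 0 by near: y.
have -> : \sum_(l < r) rho l y ^+ 2 = sq y / f k y ^+ 2.
  by rewrite /sq mulr_suml; apply: eq_bigr => l _; rewrite /rho expr_div_n.
have sy : sq y != 0 by rewrite gt_eqF// sum_sq_gt0//; exists k.
by rewrite /prj /rho; field; rewrite fk sy.
Unshelve. all: by end_near. Qed.

Lemma cE_cvg q : direction_germ q -> exists w : 'I_r -> R, forall i, cE i @ F q --> w i.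
Proof.
move=> /prj_cvg[L prjL].
exists (fun i => v i q + \sum_(j < r) L i j * (psi q j q - v j q)) => i.
rewrite (_ : cE i = fun x => v i x + \sum_(j < r) prj i j x * (psi q j x - v j x)); last first.
  by apply/funext => x; exact: cE_prj.
apply: cvgD; first by apply: cvgF; exact: vcont.
apply: cvg_sum_ord => j.
apply: cvgM; first exact: prjL.
by apply: cvgB; apply: cvgF; [exact: psicont|exact: vcont].
Qed.

(** The explicit solution on [E], its limit where the line has one, and [v] at the remaining points,
    null or bad. *)
Let c i x := if pselect (E x) then cE i x else
  if pselect (direction_germ x) is left h then sval (cid (cE_cvg h)) i else v i x.

Lemma sol_on_support i x : E x -> c i x = cE i x.
Proof. by rewrite /c; case: pselect. Qed.

Lemma sol_off_support i x : ~ E x -> ~ direction_germ x -> c i x = v i x.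
Proof. by rewrite /c; case: pselect => // ? _; case: pselect. Qed.

Lemma null_germ_notE q : null_germ q -> ~ E q.
Proof. by move=> /nbhs_singleton nq [i]; rewrite nq eqxx. Qed.

Lemma null_germ_near q : null_germ q -> \forall y \near q, null_germ y.
Proof. exact: nbhs_interior. Qed.

Lemma null_germ_closure q : null_germ q -> ~ closure E q.
Proof. by move=> nq /(_ _ nq)[y [[i] + ny]]; rewrite ny eqxx. Qed.

Lemma null_germ_direction q : null_germ q -> ~ direction_germ q.
Proof. by move=> /null_germ_closure nq [/nbhs_singleton]. Qed.

Lemma cE_continuous i q : E q -> {for q, continuous (cE i)}.
Proof.
move=> Eq; apply: cvgD; first exact: vcont.
apply: cvgM; last first.
  apply: cvgV; first by rewrite gt_eqF// sum_sq_gt0.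
  apply: cvg_sum_ord => l; rewrite expr2; under eq_fun do rewrite expr2.
  by apply: cvgM; exact: fcont.
apply: cvgM; last exact: fcont.
apply: cvgB; first exact: phicont.
by apply: cvg_sum_ord => l; apply: cvgM; [exact: vcont|exact: fcont].
Qed.

Lemma sol_limit i q eps : E q \/ direction_germ q -> 0 < eps ->
  \forall y \near q, E y -> `|cE i y - c i q| < eps.
Proof.
move=> Edq eps0; have [Eq|nEq] := pselect (E q).
  rewrite sol_on_support//; have /cvgrPdist_lt/(_ eps eps0) := @cE_continuous i q Eq.
  by apply: filterS => y + _; rewrite distrC.
case: Edq => // dq; rewrite /c.
case: pselect => [/nEq//|nEq2]; case: pselect => [h|/(_ dq)//].
case: (cid (cE_cvg h)) => w /= wc; have /cvgrPdist_lt/(_ eps eps0) wi := wc i.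
have {}wi : \forall y \near q, E y -> `|w i - cE i y| < eps by exact: wi.
by apply: filterS wi => y + Ey; rewrite distrC; apply.
Qed.

(** Nearby points with a limit line need no estimate of their own: they are adherent to [E], and the
    value there is a limit of values of [cE]. *)
Lemma sol_continuous_at i q :
  (forall eps, 0 < eps -> \forall y \near q, E y -> `|cE i y - c i q| < eps) ->
  (forall eps, 0 < eps -> \forall y \near q, y <> q ->
     `|c i y - c i q| < eps \/ direction_germ y) ->
  {for q, continuous (c i)}.
Proof.
move=> lim near_q; apply/cvgrPdist_lt => eps eps0.
have eps20 : 0 < eps / 2 by rewrite divr_gt0.
have h1 := nbhs_interior (lim _ eps20).
apply: filterS (filterI h1 (near_q _ eps0)) => y [yA ynear].
have [->|/eqP/ynear[|dy]] := eqVneq y q; first by rewrite subrr normr0.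
  by rewrite distrC.
have cly : closure E y by apply: nbhs_singleton; case: dy.
have [z [Ez [z1 z2]]] := cly _ (filterI yA (@sol_limit i y _ (or_intror dy) eps20)).
rewrite -(subrK (cE i z) (c i q)) -addrA (le_lt_trans (ler_normD _ _))//.
by rewrite (splitr eps) ltrD// ?z2// distrC z1.
Qed.

Hypothesis isolated : forall p, \forall q \near p, q <> p -> null_germ q \/ direction_germ q.
Hypothesis v_bad : forall p, ~ (null_germ p \/ direction_germ p) -> forall i, v i p = psi p i p.

Lemma sol_continuous i : continuous (c i).
Proof.
move=> q; have vnear eps : 0 < eps -> \forall y \near q, `|v i y - v i q| < eps.
  move=> eps0; have /cvgrPdist_lt/(_ eps eps0) := @vcont i q.
  by apply: filterS => y; rewrite distrC.
have [Eq|nEq] := pselect (E q).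
  apply: sol_continuous_at => eps eps0; first by apply: sol_limit => //; left.
  have [k fk] := Eq.
  have Enear : \forall y \near q, E y.
    have fk0 : 0 < `|f k q| by rewrite normr_gt0.
    have /cvgrPdist_lt/(_ _ fk0) := @fcont k q; apply: filterS => y fy; exists k.
    by apply: contraTneq fy => ->; rewrite subr0 ltxx.
  apply: filterS (filterI Enear (@sol_limit i q _ (or_introl Eq) eps0)) => y [Ey yc] _.
  by left; rewrite sol_on_support// yc.
have [nq|nnq] := pselect (null_germ q).
  have cq : c i q = v i q by apply: sol_off_support => //; exact: null_germ_direction.
  apply: sol_continuous_at => eps eps0.
    by apply: filterS (null_germ_near nq) => y /null_germ_notE.
  apply: filterS (filterI (null_germ_near nq) (vnear _ eps0)) => y [ny yv] _; left.
  by rewrite cq sol_off_support//; [exact: null_germ_notE|exact: null_germ_direction].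
have [dq|ndq] := pselect (direction_germ q).
  apply: sol_continuous_at => eps eps0; first by apply: sol_limit => //; right.
  apply: filterS (filterI (proj1 dq) (isolated q)) => y [cly iso] /iso[ny|]; last by right.
  by case: (null_germ_closure ny).
have cq : c i q = v i q by exact: sol_off_support.
apply: sol_continuous_at => eps eps0.
  (* At a bad point [v] agrees with [psi q], and the entries [prj] are at most 1 in absolute value,
     so [h] bounds the deviation of [cE] and tends to 0. *)
  pose h y := `|v i y - v i q| + \sum_(j < r) `|psi q j y - v j y|.
  have h0 : h @ q --> (0 : R).
    have hq : `|v i q - v i q| + \sum_(j < r) `|psi q j q - v j q| = 0.
      rewrite subrr normr0 add0r big1// => j _.
      have -> : v j q = psi q j q by apply: v_bad => -[].
      by rewrite subrr normr0.
    rewrite -hq.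
    apply: cvgD; first by apply: cvg_norm; apply: cvgB; [exact: vcont|exact: cvg_cst].
    apply: cvg_sum_ord => j; apply: cvg_norm; apply: cvgB; first exact: psicont.
    exact: vcont.
  have /cvgrPdist_lt/(_ eps eps0) := h0; apply: filterS => y.
  rewrite sub0r normrN => hy _; rewrite cq (cE_prj q) addrAC (le_lt_trans _ hy)//.
  rewrite (le_trans _ (ler_norm _))// (le_trans (ler_normD _ _))// lerD2l.
  rewrite (le_trans (ler_norm_sum _ _ _))// ler_sum// => j _.
  by rewrite normrM ler_piMl// prj_le1.
apply: filterS (filterI (isolated q) (vnear _ eps0)) => y [iso yv] /iso[ny|]; last by right.
by left; rewrite cq sol_off_support//; [exact: null_germ_notE|exact: null_germ_direction].
Qed.

Lemma sol_eq x : phi x = \sum_(i < r) c i x * f i x.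
Proof.
have [Ex|nE] := pselect (E x); last first.
  have f0 l : f l x = 0.
    by apply/eqP; apply: contrapT => /negP fl; apply: nE; exists l.
  by rewrite (psiE x) !big1// => i _; rewrite f0 mulr0.
have s0 : sq x != 0 by rewrite gt_eqF// sum_sq_gt0.
under eq_bigr do rewrite (sol_on_support _ Ex) /cE mulrDl.
rewrite big_split /=.
have -> : \sum_(i < r) (phi x - \sum_(j < r) v j x * f j x) * f i x / sq x * f i x =
    phi x - \sum_(j < r) v j x * f j x; last by rewrite addrC subrK.
transitivity ((phi x - \sum_(j < r) v j x * f j x) / sq x * sq x); last by rewrite divfK.
by rewrite /sq mulr_sumr; apply: eq_bigr => i _; rewrite /sq; ring.
Qed.

Lemma solution_of_isolated_bad_points : exists phi_ : 'I_r -> T -> R,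
  (forall i, continuous (phi_ i)) /\ (forall x, phi x = \sum_(i < r) phi_ i x * f i x).
Proof. by exists c; split; [exact: sol_continuous|exact: sol_eq]. Qed.
End assembly.

(** * Continuous rational functions on a nonsingular surface *)

Lemma nbhs_set_typeP (R : realType) n (X : set 'rV[R]_n) (x : X) (A : set X) :
  nbhs x A <-> exists2 d : R, 0 < d & forall y : X, `|set_val y - set_val x| < d -> A y.
Proof.
split=> [/nbhs_ballP[d d0 dA]|[d d0 dA]].
  exists d => // y xy; apply: dA.
  have : ball (set_val x) d (set_val y) by rewrite -ball_normE /= distrC.
  exact.
apply/nbhs_ballP; exists d => //= y xy; apply: dA.
have : ball (set_val x) d (set_val y) by exact: xy.
by rewrite -ball_normE /= distrC.
Qed.

Section continuous_rational_functions.
Variables (R : realType) (n : nat) (X : set 'rV[R]_n).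

(** Moves functions on [X] to the ambient space, where the chart lemmas are stated; 0 is the default
    value off [X]. *)
Definition extend (h : X -> R) (x : 'rV[R]_n) : R :=
  if pselect (X x) is left Xx then h (SigSub (mem_set Xx)) else 0.

Lemma set_val_inX (x : X) : X (set_val x).
Proof. exact: set_valP. Qed.

Lemma extendE h (x : X) : extend h (set_val x) = h x.
Proof.
rewrite /extend; case: pselect => [Xx|]; last by case; exact: set_val_inX.
by congr h; apply: val_inj.
Qed.

Lemma set_val_onto x : X x -> exists y : X, set_val y = x.
Proof. by move=> Xx; exists (SigSub (mem_set Xx)). Qed.

Lemma extend_continuous h : continuous h -> forall q eps, X q -> 0 < eps ->
  exists2 d, 0 < d & forall y, X y -> `|y - q| < d -> `|extend h y - extend h q| < eps.
Proof.
move=> hc q eps /set_val_onto[x <-] eps0.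
have /cvgrPdist_lt/(_ eps eps0)/nbhs_set_typeP[d d0 dP] := hc x.
exists d => // _ /set_val_onto[y <-] yx; rewrite !extendE distrC; exact: dP.
Qed.

Lemma near_set_type (q : X) (A : set 'rV[R]_n) :
  near_on X (set_val q) A -> \forall y \near q, A (set_val y).
Proof.
move=> [d d0 dA]; apply/nbhs_set_typeP; exists d => // y yq.
by apply: dA => //; exact: set_val_inX.
Qed.

Lemma good_at_germ r (f : 'I_r -> X -> R) (q : X) :
  good_at X (fun i => extend (f i)) (set_val q) -> null_germ f q \/ direction_germ f q.
Proof.
case=> [nq|[dq [k [c rat]]]]; [left|right].
  by apply: filterS (near_set_type nq) => y y0 i; have := y0 i; rewrite extendE.
split; last first.
  exists k, c => eps eps0; apply: filterS (near_set_type (rat _ eps0)) => y yr i.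
  by have := yr i; rewrite !extendE.
apply: filterS (near_set_type dq) => y yd A /nbhs_set_typeP[d d0 dA].
have [_ [/set_val_onto[z <-] zy [i fi]]] := yd d d0.
exists z; split; last exact: dA.
by exists i; move: fi; rewrite extendE.
Qed.

Variables (i0 i1 : 'I_n) (P : 'I_n -> mpoly n R).
Hypothesis i01 : i0 != i1.
Hypothesis PX : forall i, i != i0 -> i != i1 -> vanishing_ideal X (P i).
Variables (p : 'rV[R]_n) (u g : mpoly n R) (e : R) (th : R -> R -> 'rV[R]_n) (K : R).
Hypothesis ch : chart X i0 i1 P p u g e th K.
Hypothesis dimX : has_dimension X 2.
Local Notation V := (chart_dom p u g e th).

Lemma local_fraction (f : X -> R) : continuous_rational f ->
  exists Q F, ~ vanishing_ideal V Q /\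
    forall y, V y -> pev y Q * extend f y = pev y F.
Proof.
move=> [fc [D [[S DE] Ddense Dreg]]]; subst D.
have [x Vx Sx] : exists2 x, V x & ~ zeros S x.
  apply: (dense_meets_chart i01 PX ch dimX) => F [x Xx Fx].
  have [x' x'E] := set_val_onto Xx.
  have oU : zariski_open [set y : X | ~ zeros [set F] (set_val y)] by exists [set F].
  have [|y [Fy Sy]] := Ddense _ oU.
    exists x' => /(_ F erefl); rewrite x'E -pev_meval.
    by move/eqP; rewrite (negPf Fx).
  exists (set_val y); split=> //; first exact: set_val_inX.
  by apply/eqP => Fy0; apply: Fy => _ ->; rewrite -pev_meval.
have [x' x'E] := set_val_onto (chart_domX ch Vx).
have Dx' : [set y : X | ~ zeros S (set_val y)] x' by rewrite /= x'E.
have [U [F [Q [[S' UE] Ux fE]]]] := Dreg x' Dx'; subst U.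
have nonzero S1 y : ~ zeros S1 y -> exists2 G : mpoly n R, S1 G & pev y G != 0.
  move=> S1y; apply: contrapT => noG; apply: S1y => G SG; apply: contrapT => /eqP Gy.
  by apply: noG; exists G.
have VI y G : V y -> pev y G != 0 -> ~ vanishing_ideal V G.
  by move=> Vy /eqP Gy VG; apply: Gy; rewrite pev_meval VG.
have [Qx _] := fE x' (conj Dx' Ux); rewrite x'E -pev_meval in Qx.
exists Q, F; split; first exact: VI Vx Qx.
have [G1 SG1 G1x] := nonzero _ _ Sx.
have [G2 SG2 G2x] : exists2 G : mpoly n R, S' G & pev x G != 0.
  by apply: nonzero; rewrite -x'E.
have VG : ~ vanishing_ideal V (G1 * G2) by apply: (VI x); rewrite // pevM mulf_neq0.
move=> y Vy; apply/eqP; apply: contrapT => /negP yn.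
have [y' y'E] := set_val_onto (chart_domX ch Vy).
pose h (z : X) := pev (set_val z) Q * f z - pev (set_val z) F.
have hy : 0 < `|h y'|.
  by rewrite normr_gt0 /h -extendE y'E subr_eq0.
have pc G : continuous (fun z : X => pev (set_val z) G).
  move=> z; apply: (@continuous_comp _ _ _ (set_val : X -> 'rV[R]_n) (fun z => pev z G)).
    exact: (@initial_continuous X 'rV[R]_n set_val).
  exact: pev_continuous.
have Qfc : {for y', continuous (fun z : X => pev (set_val z) Q * f z)}.
  apply: (@cvgM R X (nbhs y') _ (fun z : X => pev (set_val z) Q) f); first exact: (pc Q y').
  exact: fc.
have hc : {for y', continuous h}.
  exact: (@cvgB R R X (nbhs y') _ _ _ _ _ Qfc (pc F y')).
have /cvgrPdist_lt/(_ _ hy)/nbhs_set_typeP[d d0 dP] := hc.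
have [z [Vz zy Gz]] := chart_dense i01 PX ch VG Vy d0.
have [z' z'E] := set_val_onto (chart_domX ch Vz).
have := dP z'; rewrite z'E y'E => /(_ zy).
move: Gz; rewrite pevM mulf_eq0 => /norP[G1z G2z].
have [|] := fE z'; last first.
  rewrite -!pev_meval => Qz fz.
  have -> : h z' = 0 by rewrite /h fz mulrC divfK// subrr.
  by rewrite subr0 ltxx.
split=> /= zS.
  by move/eqP: G1z; apply; rewrite -z'E pev_meval; exact: zS.
by move/eqP: G2z; apply; rewrite -z'E pev_meval; exact: zS.
Qed.

(** The product of the denominators stays outside the ideal of the chart because that ideal is
    prime. *)
Lemma common_denominator r (f : 'I_r -> X -> R) : (forall i, continuous_rational (f i)) ->
  exists Q (F : 'I_r -> mpoly n R), ~ vanishing_ideal V Q /\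
    forall y i, V y -> pev y Q * extend (f i) y = pev y (F i).
Proof.
move=> fr; have /choice[Q QP] : forall i, exists Q, exists F, ~ vanishing_ideal V Q /\
    forall y, V y -> pev y Q * extend (f i) y = pev y F.
  by move=> i; exact: local_fraction (fr i).
have /choice[F FP] := QP.
have [_ V1 VP] := chart_dom_prime i01 PX ch.
exists (\prod_i Q i), (fun i => \prod_(j | j != i) Q j * F i); split.
  apply: (big_ind (fun G => ~ vanishing_ideal V G)) => // [G H VG VH /VP[]//|i _].
  by have [] := FP i.
move=> y i Vy; have [_ FPi] := FP i.
by rewrite (bigD1 i)//= !pevM mulrAC FPi// mulrC.
Qed.
End continuous_rational_functions.

Theorem theorem1p5 (R : realType) (n : nat) (X : set 'rV[R]_n)
    (hX : nonsingular_surface X)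
    (r : nat) (f : 'I_r -> X -> R) (hf : forall i, continuous_rational (f i))
    (phi : X -> R) (hphi : continuous phi) :
  (exists phi_ : 'I_r -> X -> R,
    (forall i, continuous (phi_ i)) /\
    (forall x, phi x = \sum_(i < r) phi_ i x * f i x)) <->
  pointwise_test f phi.
Proof.
(* Continuous coefficients serve as [psi] at every point. *)
split=> [[c [cc cE]] p|PT]; first by exists c; split=> // i; exact: cc.
have [_ dimX ns] := hX.
have /choice[psi psiP] := PT.
have psicont q i : {for q, continuous (psi q i)} by have [] := psiP q.
have psiE q x : phi x = \sum_(i < r) psi q i x * f i x by have [] := psiP q.
have fcont i : continuous (f i) by have [] := hf i.
have iso (p : X) : \forall q \near p, q <> p -> null_germ f q \/ direction_germ f q.
  have Xp := set_val_inX p.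
  have [i0 [i1 [P [i01 PX locp [u [g J0]]]]]] := nonsingular_chart (ns _ Xp).
  have [e [th [K [ch _]]]] := chart_exists i01 PX Xp locp J0 ltr01.
  have [Q [F [VQ QF]]] := common_denominator i01 PX ch dimX hf.
  have fe i q eps := @extend_continuous R n X (f i) (@fcont i) q eps.
  have [d d0 dP] := good_punctured i01 PX fe ch locp VQ QF.
  apply/nbhs_set_typeP; exists d => // q qp qnp; apply: good_at_germ; apply: dP => //.
    exact: set_val_inX.
  by apply: contra_notN qnp => /eqP/val_inj.
pose B := [set q | ~ (null_germ f q \/ direction_germ f q)].
have isoB (p : X) : \forall q \near p, q <> p -> ~ B q.
  by apply: filterS (iso p) => q qP qnp; apply; exact: qP.
(* Bad points being isolated, each [v i] can take the prescribed value [psi q i q] at all of them at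
   once. *)
have /choice[v vP] : forall i, exists v : X -> R, continuous v /\ forall q, B q -> v q = psi q i q.
  move=> i; have [v vc vB] := interpolation (@nbhs_set_typeP R n X) (fun q => psi q i q) isoB.
  by exists v.
apply: (solution_of_isolated_bad_points fcont hphi psicont psiE (v := v)) => // [i|p Bp i].
  by have [] := vP i.
by have [_] := vP i; apply.
Qed.
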